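(* Let $(X,\varphi)$ and $(Y,\psi)$ be Cantor minimal systems. The following statements are equivalent: (1) there is a factor map from $(X,\varphi)$ to $(Y,\psi)$; (2) there are Bratteli–Vershik models $C$ and $B$ for $(X,\varphi)$ and $(Y,\psi)$, respectively, such that there is an ordered premorphism from $B$ to $C$.
   Context: A Cantor minimal system $(X,\varphi)$ is a minimal homeomorphism $\varphi$ of a space $X$ homeomorphic to the Cantor set. A factor map $(X,\varphi)\to(Y,\psi)$ is a continuous surjection $\alpha:X\to Y$ with $\alpha\circ\varphi=\psi\circ\alpha$; a conjugacy is a factor map that is a homeomorphism. **Bratteli diagrams.** A Bratteli diagram $(V,E)$ consists of a vertex set $V=V_0\sqcup V_1\sqcup\cdots$ with each $V_n$ finite and non-empty and $V_0$ a singleton, and an edge set $E=E_1\sqcup E_2\sqcup\cdots$ with each $E_n$ finite and non-empty, together with maps $r,s:E\to V$ (range, source) such that $r(E_n)\subseteq V_n$, $s(E_n)\subseteq V_{n-1}$, $s^{-1}\{v\}\neq\varnothing$ for all $v\in V$ and $r^{-1}\{v\}\ne\varnothing$ for all $v\in V\setminus V_0$. An ordered Bratteli diagram $(V,E,\geq)$ is a Bratteli diagram with a partial order on $E$ such that $e,e'$ are comparable iff $r(e)=r(e')$. It is properly ordered if there is exactly one infinite path $x_{\max}=(e_1,e_2,\ldots)$ ($e_i\in E_i$, $r(e_i)=s(e_{i+1})$) consisting of maximal edges, and exactly one, $x_{\min}$, consisting of minimal edges. For $B$ properly ordered, $X_B$ is the space of infinite paths, with the cylinder sets as a basis of the topology,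 and the Vershik homeomorphism $\lambda_B$ is given by $\lambda_B(x_{\max})=x_{\min}$ and, for other $x=(e_1,e_2,\ldots)$, with $k$ least such that $e_k$ is not maximal, $f_k$ the successor of $e_k$ in $r^{-1}\{r(e_k)\}$ and $(f_1,\ldots,f_{k-1})$ the path of minimal edges from $V_0$ to $s(f_k)$, by $\lambda_B(x)=(f_1,\ldots,f_k,e_{k+1},\ldots)$. A Bratteli–Vershik model for $(X,\varphi)$ is a properly ordered Bratteli diagram $B$ such that $(X_B,\lambda_B)$ is conjugate to $(X,\varphi)$. **Edge sets.** An ordered edge set from a finite set $S$ to a finite set $T$ is a finite set $F$ with maps $s:F\to S$, $r:F\to T$ and a linear order on each $r^{-1}\{w\}$, $w\in T$. If $G$ is an ordered edge set from $T$ to $U$, then $F\circ G=\{(e,g)\in F\times G: r(e)=s(g)\}$, with source $s(e)$, range $r(g)$, and order: for $r(g)=r(g')$, $(e,g)<(e',g')$ iff $g<g'$, or $g=g'$ and $e<e'$. Write $F\cong F'$ if there is a bijection $F\to F'$ preserving sources, ranges and order. For $k<l$, $E_{k,l}=E_{k+1}\circ\cdots\circ E_l$; $E_{k,k}$ consists of one edge from $v$ to $v$ for each $v\in V_k$. **Ordered premorphisms.** An ordered premorphism $f:B=(V,E,\ge)\to C=(W,S,\ge)$ is a triple $(F,(f_n)_{n\ge0},\geq)$ where $(f_n)$ is an unbounded sequence of integers with $0=f_0\le f_1\le\cdots$, and $F=F_0\sqcup F_1\sqcup\cdots$ where each $F_n$ is a non-empty finite ordered edge set from $V_n$ to $W_{f_n}$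 such that every $v\in V_n$ is the source and every $w\in W_{f_n}$ the range of some edge of $F_n$, $F_0$ is a singleton, and $E_{n+1}\circ F_{n+1}\cong F_n\circ S_{f_n,f_{n+1}}$ for all $n\ge0$. *)

(* Defs.v *)
From HB Require Import structures.
From mathcomp Require Import all_boot all_order all_algebra.
From mathcomp Require Import all_classical all_reals all_analysis.

Set Implicit Arguments.
Unset Strict Implicit.
Unset Printing Implicit Defensive.

Local Open Scope classical_set_scope.

Section Dynamics.
Implicit Types X Y : topologicalType.

Definition homeomorphism X Y (h : X -> Y) : Prop :=
  exists g : Y -> X,
    [/\ continuous h, continuous g, cancel h g & cancel g h].

Definition minimal_map X (phi : X -> X) : Prop :=
  forall A : set X, closed A -> phi @` A = A -> A = set0 \/ A = setT.

Definition cantor_minimal_system X (phi : X -> X) : Prop :=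
  [/\ exists h : X -> cantor_space, homeomorphism h,
      homeomorphism phi & minimal_map phi].

Definition factor_map X (phi : X -> X) Y (psi : Y -> Y) (a : X -> Y) : Prop :=
  [/\ continuous a, forall y, exists x, a x = y
    & forall x, a (phi x) = psi (a x)].

Definition conjugacy X (phi : X -> X) Y (psi : Y -> Y) (h : X -> Y) : Prop :=
  factor_map phi psi h /\ homeomorphism h.

End Dynamics.

(** The linear orders on the fibres of the range map are bundled into a single
    partial order for which two edges are comparable iff they have the same
    range. *)
Record oedges (S T : finType) := OEdges {
  edge :> finType;
  src : edge -> S;
  rng : edge -> T;
  ele : rel edge;
  ele_refl : reflexive ele;
  ele_anti : antisymmetric ele;
  ele_trans : transitive ele;
  ele_comparable : forall e f, (ele e f || ele f e) = (rng e == rng f) }.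

Arguments src {S T} o e : rename.
Arguments rng {S T} o e : rename.
Arguments ele {S T} o e f : rename.

Section EdgeOrder.
Variables (S T : finType) (F : oedges S T).
Implicit Types e f g : F.

Definition elt e f := (e != f) && ele F e f.

Definition emax e := forall f, ele F e f -> f = e.
Definition emin e := forall f, ele F f e -> f = e.
Definition esucc e f := elt e f /\ forall g, elt e g -> ele F f g.

End EdgeOrder.

Definition oedges_iso (S T : finType) (F G : oedges S T) : Prop :=
  exists h : F -> G,
    [/\ bijective h, forall e, src G (h e) = src F e,
        forall e, rng G (h e) = rng F e
      & forall e f, ele G (h e) (h f) = ele F e f].

Section Identity.
Variable S : finType.

Fact id_le_anti : antisymmetric (@eq_op S).
Proof. by move=> x y /andP[/eqP]. Qed.

Fact id_le_trans : transitive (@eq_op S).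
Proof. exact: eq_op_trans. Qed.

Fact id_le_comparable (x y : S) : ((x == y) || (y == x)) = (x == y).
Proof. by rewrite (eq_sym y) orbb. Qed.

Definition oid : oedges S S :=
  @OEdges S S S id id eq_op (@eqxx S) id_le_anti id_le_trans id_le_comparable.

End Identity.

Section Composition.
Variables (S T U : finType) (F : oedges S T) (G : oedges T U).

Definition comp_edge : finType := {p : F * G | rng F p.1 == src G p.2}.

Definition comp_src (p : comp_edge) : S := src F (val p).1.
Definition comp_rng (p : comp_edge) : U := rng G (val p).2.

Definition comp_le : rel comp_edge := fun p q =>
  elt (val p).2 (val q).2 ||
  ((val p).2 == (val q).2) && ele F (val p).1 (val q).1.

Fact comp_le_refl : reflexive comp_le.
Proof. by move=> p; rewrite /comp_le eqxx ele_refl orbT. Qed.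

Fact comp_le_anti : antisymmetric comp_le.
Proof.
move=> [[e g] /= p] [[e' g'] /= q]; rewrite /comp_le /elt /= => H.
apply/val_inj => /=; move: H; rewrite (eq_sym g').
case: eqVneq => [-> /=|neq /=].
  by move/ele_anti ->.
by rewrite !orbF => /ele_anti H; rewrite H eqxx in neq.
Qed.

Fact comp_le_trans : transitive comp_le.
Proof.
move=> [[e2 g2] /= p2] [[e1 g1] /= p1] [[e3 g3] /= p3].
rewrite /comp_le /elt /=.
case: (eqVneq g1 g2) => [<-|n12] /=.
  case: (eqVneq g1 g3) => //= _; exact: ele_trans.
rewrite orbF => l12.
case: (eqVneq g2 g3) => [<- _|n23] /=; first by rewrite n12 l12.
rewrite orbF => l23; rewrite (ele_trans l12 l23) andbT.
case: eqVneq => //= e13; exfalso; move: n12; rewrite -e13 in l23.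
by rewrite (ele_anti (introT andP (conj l12 l23))) eqxx.
Qed.

Fact comp_le_comparable p q :
  (comp_le p q || comp_le q p) = (comp_rng p == comp_rng q).
Proof.
move: p q => [[e g] /= p] [[e' g'] /= q].
rewrite /comp_le /comp_rng /elt /= -ele_comparable (eq_sym g').
case: eqVneq => [eg|_] /=; last by rewrite !orbF.
subst g'; rewrite ele_refl /= ele_comparable.
by rewrite (eqP p) (eqP q) eqxx.
Qed.

Definition ocomp : oedges S U :=
  @OEdges S U comp_edge comp_src comp_rng comp_le
    comp_le_refl comp_le_anti comp_le_trans comp_le_comparable.

End Composition.

(** [edg B n] is the edge set from level [n] to level [n.+1], i.e. E_(n+1). *)
Record ordered_bratteli := OrderedBratteli {
  vtx : nat -> finType;
  edg : forall n, oedges (vtx n) (vtx n.+1);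
  vtx0_single : #|vtx 0| = 1;
  vtx_gt0 : forall n, 0 < #|vtx n|;
  edg_gt0 : forall n, 0 < #|edg n|;
  src_surj : forall n (v : vtx n), exists e, src (edg n) e = v;
  rng_surj : forall n (w : vtx n.+1), exists e, rng (edg n) e = w }.

Arguments vtx : clear implicits.
Arguments edg : clear implicits.

Section Segments.
Variable B : ordered_bratteli.

(** E_(k,d+k); the initial identity edge set is neutral for [ocomp] up to
    [oedges_iso]. *)
Fixpoint seg_add (k d : nat) : oedges (vtx B k) (vtx B (d + k)) :=
  match d with
  | 0 => oid (vtx B k)
  | d'.+1 => ocomp (seg_add k d') (edg B (d' + k))
  end.

Definition seg (k l : nat) (kl : k <= l) : oedges (vtx B k) (vtx B l) :=
  ecast m (oedges (vtx B k) (vtx B m)) (subnK kl) (seg_add k (l - k)).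

End Segments.

Record inf_path (B : ordered_bratteli) := InfPath {
  edge_at :> forall n, edg B n;
  edge_at_adj : forall n,
    rng (edg B n) (edge_at n) = src (edg B n.+1) (edge_at n.+1) }.

HB.instance Definition _ B := gen_eqMixin (inf_path B).
HB.instance Definition _ B := gen_choiceMixin (inf_path B).

Section PathSpace.
Variable B : ordered_bratteli.
Implicit Types x y : inf_path B.

(** Every finite path starting at the top vertex is an initial segment of an
    infinite one, so cylinders may be indexed by [x] and a length [n]. *)
Definition cylinder x n : set (inf_path B) :=
  [set y | forall i, i < n -> y i = x i].

Definition cylinders : set (set (inf_path B)) :=
  [set A | exists x n, A = cylinder x n].

Fact cylinders_cover : \bigcup_(A in cylinders) A = setT.
Proof.
by apply/seteqP; split=> // x _; exists (cylinder x 0) => //; exists x, 0.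
Qed.

Fact cylinders_join A A' x : cylinders A -> cylinders A' -> A x -> A' x ->
  exists C, [/\ cylinders C, C x & C `<=` A `&` A'].
Proof.
move=> [y [n ->]] [z [m ->]] xy xz; exists (cylinder x (maxn n m)); split=> //.
  by exists x, (maxn n m).
move=> t xt; split=> i lti.
  by rewrite xt ?xy // (leq_trans lti) // leq_maxl.
by rewrite xt ?xz // (leq_trans lti) // leq_maxr.
Qed.

End PathSpace.

HB.instance Definition _ (B : ordered_bratteli) :=
  isBaseTopological.Build (inf_path B)
    (@cylinders_cover B) (@cylinders_join B).

Lemma inf_path_openE (B : ordered_bratteli) (A : set (inf_path B)) :
  open A <-> forall x, A x -> exists n, cylinder x n `<=` A.
Proof.
split=> [[D DA <-] x [C DC Cx]|AP].
  have [y [n Cy]] := DA _ DC; exists n => z xz; exists C => //.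
  by move: Cx; rewrite Cy => xy i lti; rewrite xz ?xy.
exists [set C | cylinders C /\ C `<=` A]; first by move=> C [].
apply/seteqP; split=> [x [C [_ CA] Cx]|x Ax]; first exact: CA.
have [n nA] := AP x Ax; exists (cylinder x n) => //.
by split=> //; exists x, n.
Qed.

Section Vershik.
Variable B : ordered_bratteli.
Implicit Types x y : inf_path B.

Definition max_path x := forall n, emax (x n).
Definition min_path x := forall n, emin (x n).

Definition properly_ordered : Prop :=
  (exists! x, max_path x) /\ (exists! x, min_path x).

(** [y] being a path, "[y i] minimal for all [i < k]" says that
    [y 0, ..., y k.-1] is the minimal path to the source of [y k]. *)
Definition vershik_graph x y : Prop :=
  (max_path x /\ min_path y) \/
  exists k, [/\ forall i, i < k -> emax (x i), ~ emax (x k),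
    forall i, i < k -> emin (y i), esucc (x k) (y k)
    & forall i, k < i -> y i = x i].

(** The default value of [xget] is never used when [B] is properly ordered:
    see [vershikP]. *)
Definition vershik x : inf_path B := xget x [set y | vershik_graph x y].

End Vershik.

Section VershikGraph.

Lemma fibre_min (S T : finType) (F : oedges S T) (P : pred F) (e0 : F) :
  P e0 -> (forall e, P e -> rng F e = rng F e0) ->
  exists2 e, P e & forall f, P f -> ele F e f.
Proof.
move=> Pe0 Prng.
pose N e := #|[pred f : F | ele F f e]|.
have [e Pe emn] := arg_minnP N Pe0; exists e => // f Pf.
have := ele_comparable e f; rewrite !Prng // eqxx => /orP[//|fe].
have [->|nef] := eqVneq e f; first exact: ele_refl.
have := emn f Pf; rewrite leqNgt => /negP[]; apply: proper_card.
apply/properP; split; first by apply/fintype.subsetP => g; rewrite !inE => /ele_trans; apply.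
exists e; rewrite !inE ?ele_refl //; apply/negP => ef.
by move: nef; rewrite (ele_anti (introT andP (conj ef fe))) eqxx.
Qed.

Lemma ele_rng (S T : finType) (F : oedges S T) (e f : F) :
  ele F e f -> rng F e = rng F f.
Proof. by move=> ef; apply/eqP; rewrite -ele_comparable ef. Qed.

Lemma emin_ex (S T : finType) (F : oedges S T) (w : T) :
  (exists e, rng F e = w) -> exists2 e, rng F e = w & emin e.
Proof.
move=> [e0 e0w].
have [||e /eqP ew emn] := @fibre_min _ _ F [pred e | rng F e == w] e0.
- by rewrite /= e0w.
- by move=> e /eqP ->.
exists e => // f fe; apply: ele_anti.
by rewrite fe emn //= (ele_rng fe) ew.
Qed.

Lemma emin_uniq (S T : finType) (F : oedges S T) (e f : F) :
  emin e -> emin f -> rng F e = rng F f -> e = f.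
Proof.
move=> me mf /eqP; rewrite -ele_comparable => /orP[/mf//|/me//].
Qed.

Lemma esucc_ex (S T : finType) (F : oedges S T) (e : F) :
  ~ emax e -> exists f, esucc e f.
Proof.
move=> /existsNP[f0 /not_implyP[ef0 nf0]].
have [||f Pf fmn] := @fibre_min _ _ F [pred f | elt e f] f0.
- by rewrite /= /elt ef0 andbT; apply/eqP => /esym.
- by move=> f /andP[_ /ele_rng <-]; exact: ele_rng.
by exists f; split => //= g; exact: fmn.
Qed.

Variable B : ordered_bratteli.
Implicit Types x y : inf_path B.

Lemma min_prefix k (g : forall n, edg B n) :
  (forall n, k <= n -> rng (edg B n) (g n) = src (edg B n.+1) (g n.+1)) ->
  exists y, (forall i, i < k -> emin (y i)) /\ (forall i, k <= i -> y i = g i).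
Proof.
elim: k g => [|k IH] g gadj.
  by exists (InfPath (fun n => gadj n (leq0n n))).
have [e ew mine] := emin_ex (rng_surj (src (edg B k.+1) (g k.+1))).
have [|y [ymin yg]] := IH (dfwith g k e).
  move=> n; rewrite leq_eqVlt => /orP[/eqP <-|kn].
    by rewrite dfwithin dfwithout // ?neq_ltn ?ltnSn.
  by rewrite !dfwithout ?gadj // neq_ltn ?kn // ltnS (ltnW kn).
exists y; split=> i.
  rewrite ltnS leq_eqVlt => /orP[/eqP ->|/ymin//].
  by rewrite yg // dfwithin.
by move=> ki; rewrite yg 1?ltnW // dfwithout // neq_ltn ki.
Qed.

Lemma vershik_graph_ex x : properly_ordered B -> exists y, vershik_graph x y.
Proof.
move=> [_ [y0 [y0min _]]].
have [xmax|/existsNP xnmax] := pselect (max_path x).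
  by exists y0; left.
have exP : exists n, `[< ~ emax (x n) >].
  by have [n nP] := xnmax; exists n; apply/asboolP.
case: (ex_minnP exP) => k /asboolP {}nk kmin.
have [f xf] := esucc_ex nk.
have [|y [ymin yg]] := @min_prefix k (dfwith (edge_at x) k f).
  move=> n; rewrite leq_eqVlt => /orP[/eqP <-|kn].
    rewrite dfwithin dfwithout ?neq_ltn ?ltnSn //.
    by rewrite -edge_at_adj -(ele_rng (proj2 (andP xf.1))).
  by rewrite !dfwithout ?edge_at_adj // neq_ltn ?kn // ltnS (ltnW kn).
exists y; right; exists k; split=> //.
- move=> i ik; apply: contrapT => nmax.
  by have := kmin i (introT (asboolP _) nmax); rewrite leqNgt ik.
- by rewrite yg // dfwithin.
- by move=> i ki; rewrite yg 1?ltnW // dfwithout // neq_ltn ki.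
Qed.

Lemma inf_path_inj x y : (forall n, x n = y n) -> x = y.
Proof.
case: x y => [x xP] [y yP] /= xy.
have exy : x = y by apply: functional_extensionality_dep.
by subst y; congr InfPath; apply: Prop_irrelevance.
Qed.

Lemma vershik_graph_fun x y y' : properly_ordered B ->
  vershik_graph x y -> vershik_graph x y' -> y = y'.
Proof.
move=> [_ [y0 [_ y0u]]].
move=> [[xmax ymin]|[k [kx nk ymin xy yx]]]
       [[xmax' ymin']|[k' [kx' nk' ymin' xy' yx']]].
- by rewrite -(y0u _ ymin) (y0u _ ymin').
- by have := nk' (xmax k').
- by have := nk (xmax' k).
have ekk : k = k'.
  by case: (ltngtP k k') => // [/kx'|/kx].
subst k'.
have ygt i : k < i -> y i = y' i by move=> ki; rewrite yx ?yx'.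
have yk : y k = y' k.
  by apply: ele_anti; rewrite xy.2 ?xy'.2 //; [exact: xy.1|exact: xy'.1].
have ylt d : d <= k -> y (k - d) = y' (k - d).
  elim: d => [|d IH] dk; first by rewrite subn0.
  have kd : k - d.+1 < k by rewrite ltn_subrL (leq_trans _ dk).
  apply: emin_uniq; [exact: ymin|exact: ymin'|].
  by rewrite !edge_at_adj -subSn // subSS IH // ltnW.
apply: inf_path_inj => n; have [kn|nk''] := ltnP k n; first exact: ygt.
by rewrite -(subKn nk'') ylt // leq_subr.
Qed.

Lemma vershikP x y :
  properly_ordered B -> vershik_graph x y <-> y = vershik x.
Proof.
move=> pB; have gx : vershik_graph x (vershik x).
  exact: (xgetPex x (vershik_graph_ex x pB)).
by split=> [xy|->//]; apply: vershik_graph_fun pB xy gx.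
Qed.

End VershikGraph.

Definition bratteli_vershik_model (X : topologicalType) (phi : X -> X)
    (B : ordered_bratteli) : Prop :=
  properly_ordered B /\
  exists h : inf_path B -> X, conjugacy (@vershik B) phi h.

Record ordered_premorphism (B C : ordered_bratteli) := OrderedPremorphism {
  pm_lvl : nat -> nat;
  pm_lvl0 : pm_lvl 0 = 0;
  pm_lvl_le : forall n, pm_lvl n <= pm_lvl n.+1;
  pm_lvl_unbounded : forall m, exists n, m <= pm_lvl n;
  pm_edg : forall n, oedges (vtx B n) (vtx C (pm_lvl n));
  pm_edg_gt0 : forall n, 0 < #|pm_edg n|;
  pm_src_surj : forall n (v : vtx B n), exists e, src (pm_edg n) e = v;
  pm_rng_surj : forall n (w : vtx C (pm_lvl n)), exists e, rng (pm_edg n) e = w;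
  pm_edg0_single : #|pm_edg 0| = 1;
  pm_comm : forall n,
    oedges_iso (ocomp (edg B n) (pm_edg n.+1))
               (ocomp (pm_edg n) (seg C (pm_lvl_le n))) }.

(* Main.v *)
Require Import Defs.
From mathcomp Require Import all_boot all_classical all_analysis.

(** From a premorphism to a factor map: let [x] be a path of [C] and [g_0] the
    edge of [F_0]. Recursively, the isomorphism
    [F_n o S_(f_n, f_(n+1)) ~ E_(n+1) o F_(n+1)] turns [g_n] followed by the
    segment of [x] between levels [f_n] and [f_(n+1)] into an edge [e_(n+1)]
    followed by [g_(n+1)]; the image of [x] is the path [(e_n)]. Successors in a
    composition are computed lexicographically, so the map commutes with the
    Vershik maps, and it is onto by minimality.

    From a factor map to a premorphism: choose nested Kakutani-Rohlin partitions
    [Q_n] of [Y] with bases shrinking to [alpha x0], then nested partitions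
    [P_n] of [X] with bases shrinking to [x0] and such that [P_n] refines the
    pullback of [Q_n]. When a partition refines another one along a map, the
    visits of its towers to the base of the coarser partition form an ordered
    edge set, and composition of such edge sets is again the set of visits.
    Applied to [Q_n, Q_(n+1)], to [P_n, P_(n+1)] and to [Q_n, P_n] along [alpha]
    this gives the diagrams [B] and [C] and the premorphism, and both sides of
    the commutation relation are the visits of [P_(n+1)] to the base of [Q_n]. *)

Set Implicit Arguments.
Unset Strict Implicit.
Unset Printing Implicit Defensive.

Local Open Scope classical_set_scope.

(** * From a premorphism to a factor map *)

Lemma card1_eq (T : finType) (x y : T) : #|T| = 1 -> x = y.
Proof.
move=> T1; have : #|T| <= 1 by rewrite T1.
by move/fintype_le1P; apply.
Qed.

(** * Isomorphisms of ordered edge sets *)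

Section OrderedEdgeSets.
Variables (S T : finType).
Implicit Types F G : oedges S T.

Lemma elt_ele F (e f : F) : elt e f -> ele F e f.
Proof. by move=> /andP[]. Qed.

Lemma esucc_not_emax F (e f : F) : esucc e f -> ~ emax e.
Proof. by move=> [/andP[/eqP ef le] _] me; apply: ef; rewrite (me _ le). Qed.

(** Injectivity comes for free: edges with the same image lie below each other, and antisymmetry
    identifies them. *)
Lemma oedges_isoI F G (h : F -> G) :
  (forall g, exists e, h e = g) ->
  (forall e, src G (h e) = src F e) -> (forall e, rng G (h e) = rng F e) ->
  (forall e f, ele G (h e) (h f) = ele F e f) -> oedges_iso F G.
Proof.
move=> hs hsrc hrng hle; exists h; split=> //.
have hi : injective h.
  by move=> e f ef; apply: ele_anti; rewrite -!hle ef ele_refl.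
have [k hk] := choice hs.
by exists k => // e; apply: hi; rewrite hk.
Qed.

Lemma oedges_iso_sym F G : oedges_iso F G -> oedges_iso G F.
Proof.
move=> [h [[k hk kh] hsrc hrng hle]]; exists k; split=> [|e|e|e f].
- by exists h.
- by rewrite -{2}(kh e) hsrc.
- by rewrite -{2}(kh e) hrng.
- by rewrite -{2}(kh e) -{2}(kh f) hle.
Qed.

Lemma oedges_iso_trans F G H :
  oedges_iso F G -> oedges_iso G H -> oedges_iso F H.
Proof.
move=> [h [hb hsrc hrng hle]] [k [kb ksrc krng kle]].
exists (k \o h); split=> [|e|e|e f] /=; first exact: bij_comp.
- by rewrite ksrc.
- by rewrite krng.
- by rewrite kle.
Qed.

Section Transport.
Variables (F G : oedges S T) (h : F -> G).
Hypothesis hb : bijective h.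
Hypothesis hle : forall e f, ele G (h e) (h f) = ele F e f.

Lemma iso_emax e : emax e -> emax (h e).
Proof. by case: hb => k hk kh me f; rewrite -(kh f) hle => /me ->. Qed.

Lemma iso_emin e : emin e -> emin (h e).
Proof. by case: hb => k hk kh me f; rewrite -(kh f) hle => /me ->. Qed.

Lemma iso_esucc e f : esucc e f -> esucc (h e) (h f).
Proof.
case: hb => k hk kh; rewrite /esucc /elt hle (can_eq hk) => -[ef m].
by split=> // g; rewrite -(kh g) !hle (can_eq hk); exact: m.
Qed.

End Transport.
End OrderedEdgeSets.

(** * Extremal edges and successors in a composition *)

Section CompositionOrder.
Variables (S T U : finType) (F : oedges S T) (G : oedges T U).
Implicit Types p q r : ocomp F G.

Lemma ocomp_inj p q : (val p).1 = (val q).1 -> (val p).2 = (val q).2 -> p = q.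
Proof.
move=> e1 e2; apply/val_inj.
by case: (val p) (val q) e1 e2 => ? ? [? ?] /= -> ->.
Qed.

Lemma ocomp_pair (e : F) (g : G) : rng F e = src G g ->
  exists p : ocomp F G, val p = (e, g).
Proof. by move=> /eqP eg; exists (exist _ (e, g) eg). Qed.

Lemma ocomp_adj p : rng F (val p).1 = src G (val p).2.
Proof. exact/eqP/(valP p). Qed.

Lemma comp_emax p : emax (val p).1 -> emax (val p).2 -> emax p.
Proof.
move=> m1 m2 q /orP[/andP[/eqP pq /m2 qp]|/andP[/eqP e2 /m1 e1]].
  by case: pq.
exact: ocomp_inj.
Qed.

Lemma comp_emin p : emin (val p).1 -> emin (val p).2 -> emin p.
Proof.
move=> m1 m2 q /orP[/andP[/eqP pq /m2 qp]|/andP[/eqP e2 /m1 e1]].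
  by case: pq.
exact: ocomp_inj.
Qed.

Lemma comp_esucc1 p q :
  (val p).2 = (val q).2 -> esucc (val p).1 (val q).1 -> esucc p q.
Proof.
move=> e2 [/andP[/eqP n1 l1] m]; split.
  apply/andP; split; first by apply/eqP => pq; apply: n1; rewrite pq.
  by apply/orP; right; rewrite e2 eqxx.
move=> r /andP[/eqP pr /orP[l2|/andP[/eqP e2r l1r]]].
  by apply/orP; left; rewrite -e2.
apply/orP; right; rewrite -e2 e2r eqxx /=; apply: m; rewrite /elt l1r andbT.
by apply/eqP => e1; apply: pr; apply: ocomp_inj.
Qed.

Lemma comp_esucc2 p q : emax (val p).1 -> emin (val q).1 ->
  esucc (val p).2 (val q).2 -> esucc p q.
Proof.
move=> m1 m1' [l2 m2]; split.
  apply/andP; split; last by apply/orP; left.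
  by apply/eqP => pq; move: l2; rewrite pq /elt eqxx.
move=> r /andP[/eqP pr /orP[/m2 l2r|/andP[/eqP e2r /m1 e1r]]]; last first.
  by case: pr; apply: ocomp_inj.
have [e2|n2] := eqVneq (val q).2 (val r).2; last first.
  by apply/orP; left; rewrite /elt n2.
apply/orP; right; rewrite e2 eqxx /=.
have := ele_comparable (val q).1 (val r).1.
rewrite !ocomp_adj e2 eqxx => /orP[//|/m1' ->]; exact: ele_refl.
Qed.

Hypothesis Fsurj : forall w, exists e, rng F e = w.

(** To test [p] against an edge [g] above its second component, one needs an edge of [F] ending at
    the source of [g]; [Fsurj] provides it. *)
Lemma comp_emaxP p : emax p -> emax (val p).1 /\ emax (val p).2.
Proof.
move=> mp; split=> [f pf|g pg].
  have fp2 : rng F f = src G (val p).2 by rewrite -(ele_rng pf) ocomp_adj.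
  have [q qE] := ocomp_pair fp2.
  rewrite -(mp q) ?qE //.
  by apply/orP; right; rewrite qE eqxx.
have [f fg] := Fsurj (src G g).
have [q qE] := ocomp_pair fg.
have [->//|n] := eqVneq (val p).2 g.
rewrite -(mp q) ?qE //.
by apply/orP; left; rewrite qE /elt n.
Qed.

Lemma comp_eminP p : emin p -> emin (val p).1 /\ emin (val p).2.
Proof.
move=> mp; split=> [f pf|g pg].
  have fp2 : rng F f = src G (val p).2 by rewrite (ele_rng pf) ocomp_adj.
  have [q qE] := ocomp_pair fp2.
  rewrite -(mp q) ?qE //.
  by apply/orP; right; rewrite qE eqxx.
have [f fg] := Fsurj (src G g).
have [q qE] := ocomp_pair fg.
have [->//|n] := eqVneq g (val p).2.
rewrite -(mp q) ?qE //.
by apply/orP; left; rewrite qE /elt n.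
Qed.

(** Testing [q] against well-chosen pairs above [p] leaves two cases, as in an odometer: the first
    component is incremented, or it is reset and a carry increments the second. *)
Lemma comp_esuccP p q : esucc p q ->
  ((val p).2 = (val q).2 /\ esucc (val p).1 (val q).1) \/
  [/\ emax (val p).1, emin (val q).1 & esucc (val p).2 (val q).2].
Proof.
move=> [/andP[/eqP npq lpq] m].
have ltI r : p <> r -> comp_le p r -> comp_le q r.
  by move=> /eqP pr lpr; apply: m; rewrite /elt pr.
have [e2|n2] := eqVneq (val p).2 (val q).2; [left|right].
  split=> //; split.
    apply/andP; split; first by apply/eqP => e1; apply: npq; apply: ocomp_inj.
    by case/orP: lpq => [/andP[/eqP]//|/andP[_]].
  move=> g /andP[/eqP ng lg].
  have gp2 : rng F g = src G (val p).2 by rewrite -(ele_rng lg) ocomp_adj.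
  have [r rE] := ocomp_pair gp2.
  have := ltI r; rewrite /comp_le rE e2 eqxx /elt eqxx /=; apply=> //.
  by move=> pr; apply: ng; rewrite pr rE.
have l2 : elt (val p).2 (val q).2.
  by case/orP: lpq => // /andP[/eqP e2 _]; rewrite e2 eqxx in n2.
split.
(* Otherwise [(f, (val p).2)] is strictly above [p], hence above [q], against [l2]. *)
- move=> f lf; apply: contrapT => nf.
  have fp2 : rng F f = src G (val p).2 by rewrite -(ele_rng lf) ocomp_adj.
  have [r rE] := ocomp_pair fp2.
  have : comp_le q r.
    apply: ltI; first by move=> pr; apply: nf; rewrite pr rE.
    by rewrite /comp_le rE eqxx lf orbT.
  have nle : ~ ele G (val q).2 (val p).2.
    move=> l2'; move/eqP: n2; apply.
    by apply: ele_anti; rewrite (elt_ele l2).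
  rewrite /comp_le rE => /orP[/elt_ele//|/andP[/eqP e2 _]].
  by rewrite e2 eqxx in n2.
- move=> f lf.
  have fp2 : rng F f = src G (val q).2 by rewrite (ele_rng lf) ocomp_adj.
  have [r rE] := ocomp_pair fp2.
  have : comp_le q r.
    apply: ltI; first by move=> pr; move: n2; rewrite pr rE eqxx.
    by rewrite /comp_le rE l2.
  rewrite /comp_le rE /elt eqxx /= => lf'.
  by apply: ele_anti; rewrite lf.
- split=> // g lg.
  have [f fg] := Fsurj (src G g).
  have [r rE] := ocomp_pair fg.
  have : comp_le q r.
    apply: ltI; first by move=> pr; move: lg; rewrite pr rE /elt eqxx.
    by rewrite /comp_le rE lg.
  rewrite /comp_le rE => /orP[/elt_ele//|/andP[/eqP -> _]]; exact: ele_refl.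
Qed.

End CompositionOrder.

(** * Segments of infinite paths *)

Section PathSegments.
Variable B : ordered_bratteli.
Implicit Types x y : inf_path B.

Definition vert x k : vtx B k := src (edg B k) (x k).

Lemma vertS x k : vert x k.+1 = rng (edg B k) (x k).
Proof. by rewrite edge_at_adj. Qed.

(** A specification replaces an explicit formula because [seg] is a transport along an equality of
    levels. Equality of the vertices at [k] covers the empty segment [k = l], which has no edge to
    compare. *)
Definition segment_map k l (F : oedges (vtx B k) (vtx B l))
    (sp : inf_path B -> F) : Prop :=
  [/\ forall x, src F (sp x) = vert x k /\ rng F (sp x) = vert x l,
      forall x y, vert x k = vert y k ->
        (forall i, k <= i < l -> x i = y i) -> sp x = sp y,
      forall x, (forall i, k <= i < l -> emax (x i)) -> emax (sp x),
      forall x, (forall i, k <= i < l -> emin (x i)) -> emin (sp x)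
    & forall x y j, k <= j < l ->
        (forall i, k <= i < j -> emax (x i)) ->
        (forall i, k <= i < j -> emin (y i)) -> esucc (x j) (y j) ->
        (forall i, j < i < l -> y i = x i) -> esucc (sp x) (sp y)].

Lemma seg_add_map k d : exists sp : inf_path B -> seg_add B k d, segment_map sp.
Proof.
elim: d => [|d [sp [spv spE spM spm spS]]].
  exists (fun x => vert x k); split=> //.
  - by move=> x _ e /eqP.
  - by move=> x _ e /eqP.
  - by move=> x y j /andP[kj jk]; move: (leq_ltn_trans kj jk); rewrite ltnn.
have /choice[sp' sp'E] x :
    exists p : seg_add B k d.+1, val p = (sp x, x (d + k)).
  by apply: ocomp_pair; rewrite (spv x).2.
have dk : k <= d + k < d.+1 + k by rewrite leq_addl addSn ltnSn.
have widen i : k <= i < d + k -> k <= i < d.+1 + k.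
  by move=> /andP[-> /ltnW]; rewrite addSn ltnS.
exists sp'; split.
- move=> x; rewrite /= /comp_src /comp_rng sp'E /= (spv x).1 vertS.
  by split.
- move=> x y xy exy; apply: ocomp_inj; rewrite !sp'E /=;
    [|exact: exy dk].
  by apply: spE => // i /widen; apply: exy.
- move=> x mx; apply: comp_emax; rewrite sp'E /=; [|exact: mx dk].
  by apply: spM => i /widen; apply: mx.
- move=> x mx; apply: comp_emin; rewrite sp'E /=; [|exact: mx dk].
  by apply: spm => i /widen; apply: mx.
- move=> x y j /andP[kj jd']; rewrite addSn ltnS leq_eqVlt in jd'.
  (* If [j] is the last edge, the old segment is reset and the new edge advances; otherwise the
     increment stays in the old segment. *)
  case/orP: jd' => [/eqP ej|jd].
    subst j => mx my sxy _.
    apply: comp_esucc2; rewrite !sp'E //=; [exact: spM|exact: spm].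
  move=> mx my sxy exy.
  apply: comp_esucc1; rewrite !sp'E /=.
    by rewrite exy // jd ltnSn.
  apply: (spS _ _ j) => //; first by rewrite kj.
  by move=> i /andP[ji id]; rewrite exy // ji ltnW.
Qed.

Lemma seg_map k l (kl : k <= l) :
  exists sp : inf_path B -> seg B kl, segment_map sp.
Proof.
(* Once [l - k] is generalized, the transport disappears by elimination of [e]. *)
rewrite /seg; move: (l - k) (subnK kl) => d e.
case: l / e kl => _; exact: seg_add_map.
Qed.

End PathSegments.

(** * The path map induced by a premorphism *)

Section PremorphismMap.
Variables (B C : ordered_bratteli) (f : ordered_premorphism B C).
Implicit Types x y : inf_path C.

Let lvl := pm_lvl f.
Let F := pm_edg f.

Variable k : forall n,
  ocomp (F n) (seg C (pm_lvl_le f n)) -> ocomp (edg B n) (F n.+1).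
Hypothesis kP : forall n, [/\ bijective (@k n),
    forall p, src _ (k p) = src (ocomp (F n) (seg C (pm_lvl_le f n))) p,
    forall p, rng _ (k p) = rng (ocomp (F n) (seg C (pm_lvl_le f n))) p
  & forall p q, ele _ (k p) (k q) =
      ele (ocomp (F n) (seg C (pm_lvl_le f n))) p q].

Variable sp : forall n, inf_path C -> seg C (pm_lvl_le f n).
Hypothesis spP : forall n, segment_map (@sp n).

(* [(e, g')] is the image of [(g, x[lvl n, lvl n.+1])] under the isomorphism
   F_n o S -> E_(n+1) o F_(n+1). *)
Definition pm_step x n (g : F n) (e : edg B n) (g' : F n.+1) : Prop :=
  exists p, val p = (g, sp n x) /\ val (k p) = (e, g').

Lemma pm_step_ex x n (g : F n) : rng _ g = vert x (lvl n) ->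
  exists e g', [/\ pm_step x g e g', rng _ g' = vert x (lvl n.+1),
    src _ e = src _ g & rng _ e = src _ g'].
Proof.
move=> gx.
have [|p pE] := @ocomp_pair _ _ _ (F n) (seg C (pm_lvl_le f n)) g (sp n x).
  by have [spv _ _ _ _] := @spP n; rewrite (spv x).1.
exists (val (k p)).1, (val (k p)).2; split.
- by exists p; split=> //; case: (val (k p)).
- have [_ _ kr _] := @kP n.
  rewrite -[LHS]/(rng (ocomp _ _) (k p)) kr /= /comp_rng pE.
  by have [spv _ _ _ _] := @spP n; rewrite (spv x).2.
- have [_ ks _ _] := @kP n.
  rewrite -[LHS]/(src (ocomp _ _) (k p)) ks /= /comp_src pE.
  by [].
- exact: ocomp_adj.
Qed.

Lemma pm_thread_ex x : exists (g : forall n, F n) (y : inf_path B),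
  forall n, pm_step x (g n) (y n) (g n.+1).
Proof.
(* The recursion state carries the proof that [g] ends on the path [x], which is what the next step
   requires. *)
pose St n := {g : F n | rng _ g = vert x (lvl n)}.
have g0 : St 0 by exact: cid (pm_rng_surj (vert x (lvl 0))).
have /all_tag[stp stpP] (n : nat) : {stp : St n -> edg B n * St n.+1 &
    forall g : St n, [/\ pm_step x (sval g) (stp g).1 (sval (stp g).2),
      src _ (stp g).1 = src _ (sval g)
      & rng _ (stp g).1 = src _ (sval (stp g).2)]}.
  apply: (@choice _ _ (fun (g : St n) (eg : edg B n * St n.+1) =>
    [/\ pm_step x (sval g) eg.1 (sval eg.2), src _ eg.1 = src _ (sval g)
      & rng _ eg.1 = src _ (sval eg.2)])) => -[g gx].
  have [e [g' [st g'x es er]]] := pm_step_ex gx.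
  by exists (e, exist _ g' g'x).
pose g := fix g n : St n := if n is m.+1 then (stp m (g m)).2 else g0.
pose e n := (stp n (g n)).1.
have eadj n : rng (edg B n) (e n) = src (edg B n.+1) (e n.+1).
  have [_ _ ->] := stpP n (g n).
  by have [_ -> _] := stpP n.+1 (g n.+1).
exists (fun n => sval (g n)), (InfPath eadj) => n.
by have [] := stpP n (g n).
Qed.

Section Thread.
Variables (g : inf_path C -> forall n, F n) (pm_map : inf_path C -> inf_path B).
Hypothesis pm_mapP : forall x n, pm_step x (g x n) (pm_map x n) (g x n.+1).

Let pm_step_fun x x' n h h' e e' g1 g1' :
  @pm_step x n h e g1 -> @pm_step x' n h' e' g1' -> h = h' ->
  vert x (lvl n) = vert x' (lvl n) ->
  (forall i, lvl n <= i < lvl n.+1 -> x i = x' i) -> e = e' /\ g1 = g1'.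
Proof.
move=> [p [pE kpE]] [p' [pE' kpE']] hh xx' exx'.
have [_ spE _ _ _] := @spP n.
have pp : p = p'.
  by apply: ocomp_inj; rewrite pE pE' //=; apply: spE.
by move: kpE; rewrite pp kpE' => -[].
Qed.

Let g0_uniq x y : g x 0 = g y 0.
Proof. exact: card1_eq (pm_edg0_single f). Qed.

Lemma pm_lvl_mono m n : m <= n -> lvl m <= lvl n.
Proof.
elim: n => [|n IH]; first by rewrite leqn0 => /eqP ->.
rewrite leq_eqVlt => /orP[/eqP -> //|/IH h]; exact: leq_trans h (pm_lvl_le f n).
Qed.

(** The recursion starts from the single edge of [F 0] and reads only a prefix of the path. The
    bound is not strict: the vertex on level [lvl n] is read off the edge [x (lvl n)], and
    [lvl n = lvl N] may occur with [n < N]. *)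
Lemma pm_map_local x y N : (forall i, i <= lvl N -> x i = y i) ->
  forall n, n < N -> pm_map x n = pm_map y n.
Proof.
move=> xy.
have gxy n : n <= N -> g x n = g y n.
  elim: n => [_|n IH nN]; first exact: g0_uniq.
  have [] := pm_step_fun (pm_mapP x n) (pm_mapP y n) (IH (ltnW nN)) _ _ => //.
    by rewrite /vert xy //; apply: pm_lvl_mono; apply: ltnW.
  move=> i /andP[_ il]; apply: xy; apply: ltnW; apply: leq_trans il _.
  exact: pm_lvl_mono.
move=> n nN.
have [] := pm_step_fun (pm_mapP x n) (pm_mapP y n) (gxy _ (ltnW nN)) _ _ => //.
  by rewrite /vert xy //; apply: pm_lvl_mono; apply: ltnW.
move=> i /andP[_ il]; apply: xy; apply: ltnW; apply: leq_trans il _.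
exact: pm_lvl_mono.
Qed.

Lemma pm_map_continuous : continuous pm_map.
Proof.
apply/continuousP => A /inf_path_openE Ao; apply/inf_path_openE => x Ax.
have [N NA] := Ao _ Ax; exists (lvl N).+1 => y xy; apply: NA => n nN.
by apply: pm_map_local nN => i iN; rewrite xy.
Qed.

Let surjE n (w : vtx B n.+1) : exists e, rng (edg B n) e = w := rng_surj w.

Let pm_step_emax x n h e h' : @pm_step x n h e h' -> emax h ->
  (forall i, lvl n <= i < lvl n.+1 -> emax (x i)) -> emax e /\ emax h'.
Proof.
move=> [p [pE kpE]] mh mx; have [_ _ spM _ _] := @spP n.
have [kb _ _ kle] := @kP n.
have : emax (k p).
  by apply: (iso_emax kb kle); apply: comp_emax; rewrite pE //=; exact: spM.
by move=> /(comp_emaxP (@surjE n)); rewrite kpE.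
Qed.

Let pm_step_emin x n h e h' : @pm_step x n h e h' -> emin h ->
  (forall i, lvl n <= i < lvl n.+1 -> emin (x i)) -> emin e /\ emin h'.
Proof.
move=> [p [pE kpE]] mh mx; have [_ _ _ spM _] := @spP n.
have [kb _ _ kle] := @kP n.
have : emin (k p).
  by apply: (iso_emin kb kle); apply: comp_emin; rewrite pE //=; exact: spM.
by move=> /(comp_eminP (@surjE n)); rewrite kpE.
Qed.

Let g0_emax x : emax (g x 0).
Proof. by move=> h _; apply: card1_eq (pm_edg0_single f). Qed.

Let g0_emin x : emin (g x 0).
Proof. by move=> h _; apply: card1_eq (pm_edg0_single f). Qed.

Let pm_emax x n : (forall i, i < lvl n -> emax (x i)) ->
  emax (g x n) /\ forall i, i < n -> emax (pm_map x i).
Proof.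
elim: n => [_|n IH mx]; first by split=> //; exact: g0_emax.
have [|gm em] := IH.
  by move=> i il; apply: mx; apply: leq_trans il _; exact: pm_lvl_mono.
have [|me mg] := pm_step_emax (pm_mapP x n) gm.
  by move=> i /andP[_]; exact: mx.
by split=> // i; rewrite ltnS leq_eqVlt => /orP[/eqP ->|/em].
Qed.

Let pm_emin x n : (forall i, i < lvl n -> emin (x i)) ->
  emin (g x n) /\ forall i, i < n -> emin (pm_map x i).
Proof.
elim: n => [_|n IH mx]; first by split=> //; exact: g0_emin.
have [|gm em] := IH.
  by move=> i il; apply: mx; apply: leq_trans il _; exact: pm_lvl_mono.
have [|me mg] := pm_step_emin (pm_mapP x n) gm.
  by move=> i /andP[_]; exact: mx.
by split=> // i; rewrite ltnS leq_eqVlt => /orP[/eqP ->|/em].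
Qed.

(* The prefixes of [x] and [x'] below level [lvl n] are consecutive; their
   images are consecutive either already on the [B] side ([merged]) or only
   through the edge of [F n] ([carrying]). *)
Lemma pm_map_graph x x' :
  vershik_graph x x' -> vershik_graph (pm_map x) (pm_map x').
Proof.
move=> [[xmax xmin]|[j [xmax nmax xmin xs xeq]]].
  left; split=> n.
    by have [_] := @pm_emax x n.+1 (fun i _ => xmax i); apply.
  by have [_] := @pm_emin x' n.+1 (fun i _ => xmin i); apply.
pose y := pm_map x; pose y' := pm_map x'.
pose carried n := forall i, i < n -> emax (y i) /\ emin (y' i).
pose carrying n := carried n /\ esucc (g x n) (g x' n).
pose merged n := g x n = g x' n /\ exists j', [/\ j' < n, carried j',
  esucc (y j') (y' j') & forall i, j' < i < n -> y' i = y i].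
have vx n : j < lvl n -> vert x (lvl n) = vert x' (lvl n).
  by move=> jn; rewrite /vert xeq.
(* The isomorphism keeps the pairs consecutive; on the [B] side the increment either stops in
   [edg B n] or carries into [F n.+1]. *)
have split_succ n (p p' : ocomp (F n) (seg C (pm_lvl_le f n))) :
    val p = (g x n, sp n x) -> val p' = (g x' n, sp n x') ->
    esucc p p' -> carried n -> carrying n.+1 \/ merged n.+1.
  move=> pE p'E pp' cn; have [kb _ _ kle] := @kP n.
  have := comp_esuccP (@surjE n) (iso_esucc kb kle pp').
  have [q [qE kqE]] := pm_mapP x n; have [q' [q'E kq'E]] := pm_mapP x' n.
  have -> : p = q by apply: val_inj; rewrite pE.
  have -> : p' = q' by apply: val_inj; rewrite p'E.
  rewrite kqE kq'E /= => -[[gg ss]|[mx mn ss]]; [right|left].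
    split=> //; exists n; split=> // i /andP[ni].
    rewrite ltnS => /(leq_trans ni).
    by rewrite ltnn.
  split=> // i; rewrite ltnS leq_eqVlt => /orP[/eqP ->|/cn]//.
have state n : j < lvl n -> carrying n \/ merged n.
  elim: n => [|n IH jn]; first by rewrite /lvl (pm_lvl0 f).
  have [spv spE spM spm spS] := @spP n.
  have [q [qE kqE]] := pm_mapP x n; have [q' [q'E kq'E]] := pm_mapP x' n.
  (* If [j] lies below this segment, the segment is common to both paths and only the [F]-edges can
     differ. *)
  have [jn'|nj] := ltnP j (lvl n).
    have esp : sp n x = sp n x'.
      apply: spE; first exact: vx.
      by move=> i /andP[ni _]; rewrite xeq //; apply: leq_trans ni.
    have [[cn sn]|[gg [j' [j'n cj' sj' ej']]]] := IH jn'.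
      apply: (split_succ n q q') => //.
      apply: comp_esucc1; rewrite qE q'E //.
    right.
    have [||ee gg'] := pm_step_fun (pm_mapP x n) (pm_mapP x' n) gg.
    - exact: vx.
    - by move=> i /andP[ni _]; rewrite xeq //; apply: leq_trans ni.
    split=> //; exists j'; split=> //; first exact: ltnW.
    move=> i /andP[ji]; rewrite ltnS leq_eqVlt => /orP[/eqP ->//|il].
    by apply: ej'; rewrite ji.
  (* Now [j] lies in this segment: everything before it is extremal, and the carry reaches the
     segment. *)
  have [gmx ymx] := @pm_emax x n (fun i il => xmax i (leq_trans il nj)).
  have [gmn ymn] := @pm_emin x' n (fun i il => xmin i (leq_trans il nj)).
  apply: (split_succ n q q') => //; last first.
    by move=> i il; split; [exact: ymx|exact: ymn].
  apply: comp_esucc2; rewrite ?qE ?q'E //=.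
  apply: (spS _ _ j) => //; first by rewrite nj.
  - by move=> i /andP[_]; exact: xmax.
  - by move=> i /andP[_]; exact: xmin.
  - by move=> i /andP[ji _]; exact: xeq.
(* After a merge the images agree for ever, so they differ by one ordinary step at [j']. Without a
   merge every edge is carried, and the maximal path is sent to the minimal one. *)
have [[n [jn [gg [j' [j'n cj' sj' ej']]]]]|nomerge] :=
    pselect (exists n, j < lvl n /\ merged n).
  right; exists j'; split=> //.
  - by move=> i /cj'[].
  - exact: esucc_not_emax sj'.
  - by move=> i /cj'[].
  have later m : n <= m -> g x m = g x' m /\ (y m = y' m).
    elim: m => [|m IH].
      by rewrite leqn0 => /eqP n0; move: j'n; rewrite n0.
    have step i : n <= i -> g x i = g x' i ->
        y i = y' i /\ g x i.+1 = g x' i.+1.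
      move=> ni gi; have jl : j < lvl i by apply: leq_trans jn (pm_lvl_mono ni).
      apply: (pm_step_fun (pm_mapP x i) (pm_mapP x' i) gi); first exact: vx.
      by move=> l /andP[il _]; rewrite xeq //; apply: leq_trans il.
    rewrite leq_eqVlt => /orP[/eqP e|nm].
      by subst n; split=> //; have [] := step m.+1 (leqnn _) gg.
    have [gm _] := IH nm; have [_ gm1] := step m nm gm.
    by split=> //; have [] := step m.+1 (ltnW nm) gm1.
  move=> i j'i; have [ni|ni] := leqP n i; first by have [_ ->] := later i ni.
  by apply: ej'; rewrite j'i.
(* The levels being unbounded, arbitrarily late stages lie beyond [j], where [state] applies. *)
have all_carried n : carried n.
  have [m jm] := pm_lvl_unbounded f j.+1.
  have jl : j < lvl (maxn m n).
    by apply: leq_trans jm _; apply: pm_lvl_mono; exact: leq_maxl.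
  have [[cm _]|mg] := state _ jl; last by case: nomerge; exists (maxn m n).
  by move=> i il; apply: cm; apply: leq_trans il _; exact: leq_maxr.
by left; split=> n; have [] := all_carried n.+1 n (ltnSn n).
Qed.

End Thread.
End PremorphismMap.

Lemma premorphism_map (B C : ordered_bratteli) (f : ordered_premorphism B C) :
  exists2 a : inf_path C -> inf_path B, continuous a
    & forall x x', vershik_graph x x' -> vershik_graph (a x) (a x').
Proof.
have /all_sig[k kP] n := cid (oedges_iso_sym (pm_comm f n)).
have /all_sig[sp spP] n := cid (seg_map C (pm_lvl_le f n)).
have /choice[g /choice[a aP]] := pm_thread_ex kP spP.
exists a; first exact: pm_map_continuous aP.
exact: pm_map_graph aP.
Qed.

(** * Compactness, and the factor map between the original systems *)

Lemma homeo_inv (X Y : topologicalType) (h : X -> Y) : homeomorphism h ->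
  exists2 g : Y -> X, homeomorphism g & cancel h g /\ cancel g h.
Proof. by move=> [g [hc gc hg gh]]; exists g => //; exists h. Qed.

Lemma cantor_compact (X : topologicalType) (h : X -> cantor_space) :
  homeomorphism h -> compact [set: X].
Proof.
move=> [g [hc gc hg gh]].
have -> : [set: X] = g @` setT.
  by apply/seteqP; split=> // x _; exists (h x).
apply: continuous_compact; last exact: cantor_space_compact.
by apply: continuous_subspaceT.
Qed.

Lemma cantor_hausdorff (X : topologicalType) (h : X -> cantor_space) :
  homeomorphism h -> hausdorff_space X.
Proof.
move=> [g [hc gc hg gh]] x y cxy.
apply: (can_inj hg); apply: cantor_space_hausdorff => A D hA hD.
have [z [zA zD]] := cxy _ _ (hc x _ hA) (hc y _ hD).
by exists (h z).
Qed.

Lemma premorphism_factor (X Y : topologicalType) (phi : X -> X) (psi : Y -> Y)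
    (B C : ordered_bratteli) :
  cantor_minimal_system phi -> cantor_minimal_system psi ->
  bratteli_vershik_model phi C -> bratteli_vershik_model psi B ->
  ordered_premorphism B C -> exists alpha : X -> Y, factor_map phi psi alpha.
Proof.
move=> [[hX hXh] [phi' [phic phi'c phiK phiK']] phim].
move=> [[hY hYh] [psi' [psic psi'c psiK psiK']] psim].
move=> [pC [hC [[hCc hCs hCe] hCh]]] [pB [hB [[hBc hBs hBe] hBh]]] f.
have [gC [? [gCc _ _ _]] [hgC ghC]] := homeo_inv hCh.
have [m mc mg] := premorphism_map f.
pose a := hB \o m \o gC.
have ac : continuous a.
  move=> x; apply: continuous_comp; first exact: gCc.
  by apply: continuous_comp; [exact: mc|exact: hBc].
have ae x : a (phi x) = psi (a x).
  have e : gC (phi x) = vershik (gC x).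
    by apply: (can_inj hgC); rewrite ghC hCe ghC.
  rewrite /a /= e -hBe; congr hB; apply/vershikP => //.
  by apply: mg; apply/vershikP.
exists a; split=> //.
(* Surjectivity: the range is compact, hence closed, and invariant and non-empty, so minimality
   makes it everything. *)
have cl : closed (range a).
  apply: compact_closed; first exact: cantor_hausdorff hYh.
  apply: continuous_compact; last exact: cantor_compact hXh.
  exact: continuous_subspaceT.
have inv : psi @` range a = range a.
  apply/seteqP; split=> [_ [_ [x _ <-] <-]|_ [x _ <-]].
    by exists (phi x).
  by exists (a (phi' x)); [exists (phi' x)|rewrite -ae phiK'].
have [e|e] := psim _ cl inv.
  have [gX _] := hXh.
  have : range a (a (gX (fun=> false))) by exists (gX (fun=> false)).
  by rewrite e.
move=> y; have : range a y by rewrite e.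
by move=> [x _ <-]; exists x.
Qed.

(** * Kakutani-Rohlin partitions and their diagrams *)

(** Kakutani-Rohlin partitions: [tow x] is the tower containing [x], [lev x] the
    floor of [x] in it, and the base is [lev x = 0]. *)
Record kr (X : Type) (phi : X -> X) := KR {
  tower : finType;
  tow : X -> tower;
  lev : X -> nat;
  ht : tower -> nat;
  lev_lt : forall x, lev x < ht (tow x);
  kr_up : forall x, (lev x).+1 < ht (tow x) ->
    tow (phi x) = tow x /\ lev (phi x) = (lev x).+1;
  kr_top : forall x, (lev x).+1 = ht (tow x) -> lev (phi x) = 0;
  kr_base : forall v, exists2 x, tow x = v & lev x = 0 }.

Arguments tower {X phi} P : rename.
Arguments tow {X phi} P x : rename.
Arguments lev {X phi} P x : rename.
Arguments ht {X phi} P v : rename.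

(** * Orbits in the towers of a partition *)

Section Towers.
Variables (X : Type) (phi : X -> X).
Implicit Types P : kr phi.

Lemma climb P x j : lev P x = 0 -> j < ht P (tow P x) ->
  tow P (iter j phi x) = tow P x /\ lev P (iter j phi x) = j.
Proof.
move=> x0; elim: j => [//|j IH] jh; have [tj lj] := IH (ltnW jh).
by have [/=|-> ->] := @kr_up _ _ P (iter j phi x); rewrite tj lj.
Qed.

Lemma iter_ht P x : lev P x = 0 -> lev P (iter (ht P (tow P x)) phi x) = 0.
Proof.
move=> x0; have h0 := lev_lt P x; rewrite -(ltn_predK h0) /=.
have [|t l] := @climb P x (ht P (tow P x)).-1 x0.
  by rewrite (ltn_predK h0).
by apply: kr_top; rewrite t l (ltn_predK h0).
Qed.

(** [m - lev P y] is the time of the last visit to the base up to time [m]. As [phi] has no inverse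
    here, the foot of [y] is located on the forward orbit of a base point. *)
Lemma descend P x m : lev P x = 0 ->
  let y := iter m phi x in
  [/\ lev P y <= m, lev P (iter (m - lev P y) phi x) = 0
    & tow P (iter (m - lev P y) phi x) = tow P y].
Proof.
move=> x0; elim: m => [|m [le l0 te]] /=; first by rewrite x0.
set y := iter m phi x in le l0 te *.
have := lev_lt P y; rewrite leq_eqVlt => /orP[/eqP top|up].
  by rewrite (kr_top top) subn0 /= (kr_top top).
by have [-> ->] := kr_up up; rewrite subSS.
Qed.

Lemma base_gap P x i : lev P x = 0 -> 0 < i -> lev P (iter i phi x) = 0 ->
  ht P (tow P x) <= i.
Proof.
move=> x0 i0 li; rewrite leqNgt; apply/negP => /(climb x0)[_].
by rewrite li => ei; rewrite -ei in i0.
Qed.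

Definition base_pt P (v : tower P) : X := s2val (cid2 (kr_base v)).
Arguments base_pt : clear implicits.

Lemma tow_base_pt P v : tow P (base_pt P v) = v.
Proof. by rewrite /base_pt; case: cid2. Qed.

Lemma lev_base_pt P v : lev P (base_pt P v) = 0.
Proof. by rewrite /base_pt; case: cid2. Qed.

Lemma ht_gt0 P (v : tower P) : 0 < ht P v.
Proof. by rewrite -(tow_base_pt v); apply: leq_trans (lev_lt _ _). Qed.

(** For [j < ht P v], a chosen representative of floor [j], on which properties constant on cells
    are tested. *)
Definition floor_pt P (v : tower P) j : X := iter j phi (base_pt P v).
Arguments floor_pt : clear implicits.

Lemma floor_ptP P v j : j < ht P v ->
  tow P (floor_pt P v j) = v /\ lev P (floor_pt P v j) = j.
Proof.
move=> jh; have [|-> ->] := @climb P (base_pt P v) j (lev_base_pt v).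
  by rewrite tow_base_pt.
by rewrite tow_base_pt.
Qed.

Lemma iter_floor_pt P v i j :
  iter i phi (floor_pt P v j) = floor_pt P v (i + j).
Proof. by rewrite /floor_pt iterD. Qed.

Lemma floor_pt_tow P x : tow P (floor_pt P (tow P x) (lev P x)) = tow P x.
Proof. by have [] := floor_ptP (lev_lt P x). Qed.

Lemma floor_pt_lev P x : lev P (floor_pt P (tow P x) (lev P x)) = lev P x.
Proof. by have [] := floor_ptP (lev_lt P x). Qed.

Lemma ht_trivial P (v : tower P) : (forall x, lev P x = 0) -> ht P v = 1.
Proof.
move=> P0; apply/eqP; rewrite eqn_leq ht_gt0 andbT leqNgt; apply/negP => h.
have [|_] := @kr_up _ _ P (base_pt P v); first by rewrite P0 tow_base_pt.
by rewrite P0.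
Qed.

Fact kr0_subproof (u : unit) : inhabited X -> exists2 x : X, tt = u & 0 = 0.
Proof. by case: u => -[x]; exists x. Qed.

(** The trivial partition, one tower of one floor; it provides the top vertex of a diagram. *)
Definition kr0 (X0 : inhabited X) : kr phi :=
  @KR X phi unit (fun=> tt) (fun=> 0) (fun=> 1) (fun=> isT)
    (fun x (h : 1 < 1) => False_ind _ (elimF idP (ltnn 1) h))
    (fun=> fun=> erefl) (fun u => kr0_subproof u X0).

End Towers.

Arguments base_pt {X phi} P v.
Arguments floor_pt {X phi} P v j.

(** * Refinement along a map and the ordered edge set of visits *)

Section Refinement.
Variables (X Y : Type) (phi : X -> X) (psi : Y -> Y) (a : X -> Y).

(** Bases are mapped into bases and cells into cells. For [a = id] this is nesting of partitions of
    one system; for a factor map it compares two systems. *)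
Definition refines (Q : kr psi) (P : kr phi) : Prop :=
  (forall x, lev P x = 0 -> lev Q (a x) = 0) /\
  (forall x x', tow P x = tow P x' -> lev P x = lev P x' ->
     tow Q (a x) = tow Q (a x') /\ lev Q (a x) = lev Q (a x')).

Hypothesis equi : forall x, a (phi x) = psi (a x).

Lemma equi_iter n x : a (iter n phi x) = iter n psi (a x).
Proof. by elim: n => //= n <-; rewrite equi. Qed.

Variables (Q : kr psi) (P : kr phi).

Section Edges.

(* An edge is a pair of a tower of [P] and a floor of it mapped by [a] into the
   base of [Q]. *)
Definition visit_cond (p : tower P * 'I_(\max_(v : tower P) ht P v)) : bool :=
  (p.2 < ht P p.1) && (lev Q (a (floor_pt P p.1 p.2)) == 0).

Definition visit_edge : finType := {p | visit_cond p}.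
Implicit Types e : visit_edge.

Definition etow e : tower P := (val e).1.
Definition elev e : nat := (val e).2.

Definition visit_src e : tower Q := tow Q (a (floor_pt P (etow e) (elev e))).
Definition visit_le : rel visit_edge :=
  fun e f => (etow e == etow f) && (elev e <= elev f).

Lemma visit_inj e e' : etow e = etow e' -> elev e = elev e' -> e = e'.
Proof.
move=> te le; apply/val_inj; move: te le; rewrite /etow /elev.
by case: (val e) (val e') => [v i] [v' i'] /= -> /val_inj ->.
Qed.

Fact visit_le_refl : reflexive visit_le.
Proof. by move=> e; rewrite /visit_le eqxx leqnn. Qed.

Fact visit_le_anti : antisymmetric visit_le.
Proof.
move=> e f /andP[/andP[/eqP te le] /andP[_ le']].
by apply: visit_inj => //; apply/eqP; rewrite eqn_leq le.
Qed.

Fact visit_le_trans : transitive visit_le.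
Proof.
move=> f e g /andP[/eqP te le] /andP[/eqP te' le'].
by rewrite /visit_le te te' eqxx (leq_trans le).
Qed.

Fact visit_le_comparable e f :
  (visit_le e f || visit_le f e) = (etow e == etow f).
Proof.
by rewrite /visit_le (eq_sym (etow f)); case: eqP => //= _; exact: leq_total.
Qed.

Definition visits : oedges (tower Q) (tower P) :=
  @OEdges _ _ visit_edge visit_src etow visit_le visit_le_refl visit_le_anti
    visit_le_trans visit_le_comparable.

Lemma elev_lt e : elev e < ht P (etow e).
Proof. by have /andP[] := valP e. Qed.

Lemma lev_visit e : lev Q (a (floor_pt P (etow e) (elev e))) = 0.
Proof. by have /andP[_ /eqP] := valP e. Qed.

Lemma visit_ex v j : j < ht P v -> lev Q (a (floor_pt P v j)) = 0 ->
  exists e, etow e = v /\ elev e = j.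
Proof.
move=> jh l0.
have jK : j < \max_(v : tower P) ht P v.
  by apply: leq_trans jh _; exact: (@leq_bigmax_cond _ _ (ht P)).
have c : visit_cond (v, Ordinal jK) by rewrite /visit_cond /= jh l0 eqxx.
by exists (exist (fun p => visit_cond p) _ c).
Qed.

End Edges.

Hypothesis QP : refines Q P.

Lemma lev_base v : lev Q (a (base_pt P v)) = 0.
Proof. by apply: QP.1; exact: lev_base_pt. Qed.

Lemma same_cell x v j : tow P x = v -> lev P x = j ->
  tow Q (a (floor_pt P v j)) = tow Q (a x) /\
  lev Q (a (floor_pt P v j)) = lev Q (a x).
Proof.
move=> <- <-; apply: QP.2; first exact: floor_pt_tow.
exact: floor_pt_lev.
Qed.

(** Between two visits the image orbit climbs a whole tower of [Q]: this is [base_gap] along [a]. *)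
Lemma visit_gap v i i' : lev Q (a (floor_pt P v i)) = 0 ->
  lev Q (a (floor_pt P v i')) = 0 -> i < i' ->
  i + ht Q (tow Q (a (floor_pt P v i))) <= i'.
Proof.
move=> l0 l0' ii'; rewrite -leq_subRL; last exact: ltnW.
apply: base_gap; rewrite ?subn_gt0 //.
by rewrite -equi_iter iter_floor_pt subnK // ltnW.
Qed.

(** After the top floor the orbit is back in the base of [P], hence over the base of [Q], so
    [ht P v] counts as one more visit in [visit_gap]. *)
Lemma visit_fit v i : i < ht P v -> lev Q (a (floor_pt P v i)) = 0 ->
  i + ht Q (tow Q (a (floor_pt P v i))) <= ht P v.
Proof.
move=> ih l0; apply: visit_gap => //.
apply: QP.1; have := @iter_ht _ _ P (base_pt P v) (lev_base_pt v).
by rewrite tow_base_pt.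
Qed.

Lemma last_visit v m : m < ht P v -> let y := a (floor_pt P v m) in
  exists e : visits, [/\ rng visits e = v, elev e + lev Q y = m
    & src visits e = tow Q y].
Proof.
move=> mh y; have yE : y = iter m psi (a (base_pt P v)) by rewrite /y equi_iter.
have [lm l0 te] := descend m (lev_base v); rewrite -yE in lm l0 te.
have [||e [ev el]] := @visit_ex v (m - lev Q y).
- exact: leq_ltn_trans (leq_subr _ _) mh.
- by rewrite equi_iter.
exists e; split=> //; first by rewrite el subnK.
by rewrite /= /visit_src ev el equi_iter.
Qed.

Lemma point_visit x : exists e : visits,
  [/\ rng visits e = tow P x, src visits e = tow Q (a x)
    & elev e + lev Q (a x) = lev P x].
Proof.
have [e [er el es]] := last_visit (lev_lt P x).
have [tE lE] := same_cell (erefl (tow P x)) (erefl (lev P x)).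
by exists e; split=> //; [rewrite es tE|rewrite -[RHS]el lE].
Qed.

Lemma visits_rng_surj v : exists e : visits, rng visits e = v.
Proof.
have [|e [ev _]] := @visit_ex v 0 (ht_gt0 v); first exact: lev_base.
by exists e.
Qed.

Lemma visits_src_surj : (forall y, exists x, a x = y) ->
  forall u, exists e : visits, src visits e = u.
Proof.
move=> asurj u; have [y <- _] := kr_base u; have [x <-] := asurj y.
by have [e [_ es _]] := point_visit x; exists e.
Qed.

Lemma visits_card_gt0 : inhabited X -> 0 < #|visits|.
Proof.
move=> [x]; have [e _] := visits_rng_surj (tow P x).
by apply/card_gt0P; exists e.
Qed.

End Refinement.

Lemma refines_id_iter (X : Type) (phi : X -> X) (P : nat -> kr phi) x x' :
  (forall n, refines id (P n) (P n.+1)) -> forall m n, m <= n ->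
  tow (P n) x = tow (P n) x' -> lev (P n) x = lev (P n) x' ->
  tow (P m) x = tow (P m) x' /\ lev (P m) x = lev (P m) x'.
Proof.
move=> ref m; elim=> [|n IH]; first by rewrite leqn0 => /eqP ->.
rewrite leq_eqVlt => /orP[/eqP -> //|mn] t l.
by have [t' l'] := (ref n).2 _ _ t l; exact: IH.
Qed.

(** * Composition of visits *)

Section VisitsComposition.
Variables (X Y Z : Type) (phi : X -> X) (psi : Y -> Y) (theta : Z -> Z).
Variables (a : Y -> Z) (b : X -> Y).
Hypothesis aE : forall y, a (psi y) = theta (a y).
Hypothesis bE : forall x, b (phi x) = psi (b x).
Variables (R : kr theta) (Q : kr psi) (P : kr phi).
Hypotheses (RQ : refines a R Q) (QP : refines b Q P).

(** A visit to [R] is located by a visit to [Q] and a floor above it. Distinct visits to [Q] occupy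
    disjoint blocks of floors, so comparing sums of floors is the lexicographic order. *)
Lemma ocomp_visits :
  oedges_iso (ocomp (visits a R Q) (visits b Q P)) (visits (a \o b) R P).
Proof.
have abE x : (a \o b) (phi x) = theta ((a \o b) x) by rewrite /= bE aE.
have RP : refines (a \o b) R P.
  split=> [x /QP.1/RQ.1//|x x' t l].
  by have [t' l'] := QP.2 _ _ t l; exact: RQ.2 t' l'.
pose c := ocomp (visits a R Q) (visits b Q P).
(* A visit to [R] on floor [j] of a tower of [Q] entered on floor [i] of a
     tower of [P] is a visit to [R] on floor [i + j]. *)
have cell (p : c) : let e := (val p).1 in let g := (val p).2 in
    [/\ elev e + elev g < ht P (etow g),
      lev Q (b (floor_pt P (etow g) (elev g))) = 0,
      elev g + ht Q (etow e) <= ht P (etow g),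
      tow R (a (b (floor_pt P (etow g) (elev e + elev g)))) = visit_src e
    & lev R (a (b (floor_pt P (etow g) (elev e + elev g)))) = 0].
  move=> e g; have eg : etow e = visit_src g by exact: (ocomp_adj p).
  have g0 := lev_visit g; have fit := visit_fit bE QP (elev_lt g) g0.
  rewrite -[tow _ _]/(visit_src g) -eg in fit.
  have [|t l] := @climb _ _ Q _ (elev e) g0.
    by rewrite -[tow _ _]/(visit_src g) -eg; exact: elev_lt.
  rewrite -[tow Q (b _)]/(visit_src g) -eg -(equi_iter bE) iter_floor_pt in t.
  rewrite -(equi_iter bE) iter_floor_pt in l.
  have [tE lE] := same_cell RQ t l.
  split=> //; first by apply: leq_trans fit; rewrite addnC ltn_add2l elev_lt.
  by rewrite -lE; exact: lev_visit.
have /choice[h hE] (p : c) : exists f : visits (a \o b) R P,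
    etow f = etow (val p).2 /\ elev f = elev (val p).1 + elev (val p).2.
  by have [lt _ _ _ l0] := cell p; exact: visit_ex.
apply: (@oedges_isoI _ _ c _ h).
(* Surjectivity: the last visit to [Q] up to [f] gives [g], and the remaining floors give [e]. *)
- move=> f; have [g [gr gl gs]] := last_visit bE QP (elev_lt f).
  set y := b _ in gl gs.
  have [||e [et el]] := @visit_ex _ _ _ _ a R Q (tow Q y) (lev Q y).
  + exact: lev_lt.
  + have [_ ->] := same_cell RQ (erefl (tow Q y)) (erefl (lev Q y)).
    exact: lev_visit f.
  have [|p pE] := @ocomp_pair _ _ _ (visits a R Q) (visits b Q P) e g.
    by rewrite gs -et.
  have [ph pl] := hE p; exists p.
  by apply: visit_inj; rewrite ?ph ?pl pE //= el addnC.
- move=> p; rewrite /= /visit_src !(hE p).1 !(hE p).2.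
  by have [_ _ _ -> _] := cell p.
- by move=> p; exact: (hE p).1.
- move=> p q; rewrite /= /visit_le !(hE p).1 !(hE p).2 !(hE q).1 !(hE q).2.
  have [plt p0 pfit _ _] := cell p; have [qlt q0 qfit _ _] := cell q.
  rewrite /comp_le /elt /= /visit_le.
  set g := (val p).2 in plt p0 pfit *; set g' := (val q).2 in qlt q0 qfit *.
  set e := (val p).1 in plt pfit *; set e' := (val q).1 in qlt qfit *.
  have eg : etow e = visit_src g by exact: (ocomp_adj p).
  have eg' : etow e' = visit_src g' by exact: (ocomp_adj q).
  case: (eqVneq (etow g) (etow g')) => [tt'|nt] /=; last first.
    rewrite andbF /=; case: eqVneq => [gg|//].
    by rewrite gg eqxx in nt.
  case: (eqVneq g g') => [gg|ng] /=.
    by rewrite eg eg' gg eqxx leq_add2r.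
  rewrite orbF.
  (* The block of floors that starts at [k] ends before a later visit [k']. *)
  have gap (k k' : visits b Q P) (d : visits a R Q) : etow k = etow k' ->
      etow d = visit_src k -> elev k < elev k' -> elev d + elev k < elev k'.
    move=> kk dk lt; have := visit_gap bE (lev_visit k) _ lt.
    rewrite {1}kk => /(_ (lev_visit k')); apply: leq_trans.
    by rewrite addnC ltn_add2l -[tow _ _]/(visit_src k) -dk elev_lt.
  case: (ltngtP (elev g) (elev g')) => [lt|gt|eq].
  + apply: ltnW; apply: leq_trans (gap _ _ _ tt' eg lt) _; exact: leq_addl.
  + apply/negbTE; rewrite -ltnNge.
    apply: leq_trans (gap _ _ _ (esym tt') eg' gt) _; exact: leq_addl.
  + by move/eqP: ng; case; exact: visit_inj.
Qed.

End VisitsComposition.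

(** * The diagram of a refining sequence and the coding of points by paths *)

Section Diagram.
Variables (X : Type) (phi : X -> X) (P : nat -> kr phi).
Hypothesis P00 : forall x, lev (P 0) x = 0.
Hypothesis P01 : #|tower (P 0)| = 1.
Hypothesis ref : forall n, refines id (P n) (P n.+1).
Hypothesis X0 : inhabited X.

Let idE x : id (phi x) = phi (id x). Proof. by []. Qed.

Fact kr_tower_gt0 n : 0 < #|tower (P n)|.
Proof. by case: X0 => x; apply/card_gt0P; exists (tow (P n) x). Qed.

Fact kr_src_surj n (v : tower (P n)) :
  exists e : visits id (P n) (P n.+1), src _ e = v.
Proof.
by apply: (visits_src_surj idE (ref n)) => y; exists y.
Qed.

Definition kr_diagram : ordered_bratteli :=
  @OrderedBratteli (fun n => tower (P n)) (fun n => visits id (P n) (P n.+1))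
    P01 kr_tower_gt0 (fun n => visits_card_gt0 (ref n) X0) kr_src_surj
    (fun n => visits_rng_surj (ref n)).

Implicit Types p : inf_path kr_diagram.


(* The [n]-th edge of [p] is the visit to the base of [P n] during which the
   orbit of the base of [P n.+1] goes through [x]. *)
Definition code_at x p n : Prop :=
  [/\ etow (p n) = tow (P n.+1) x, visit_src (p n) = tow (P n) x
    & elev (p n) + lev (P n) x = lev (P n.+1) x].

Definition code x p : Prop := forall n, code_at x p n.

Lemma code_ex x : exists p, code x p.
Proof.
have /all_sig[e eP] n := cid (point_visit idE (ref n) x).
have eadj n : rng (edg kr_diagram n) (e n) = src (edg kr_diagram n.+1) (e n.+1).
  by have [/= -> _ _] := eP n; have [_ /= -> _] := eP n.+1.
by exists (InfPath eadj).
Qed.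

Lemma code_at_same x x' p n : tow (P n.+1) x = tow (P n.+1) x' ->
  lev (P n.+1) x = lev (P n.+1) x' -> code_at x p n -> code_at x' p n.
Proof.
move=> t l; have [t' l'] := (ref n).2 _ _ t l.
by rewrite /code_at t l t' l'.
Qed.

Lemma code_at_fun x p q n : code_at x p n -> code_at x q n -> p n = q n.
Proof.
move=> [tp _ lp] [tq _ lq]; apply: visit_inj; first by rewrite tp.
by apply: (@addIn (lev (P n) x)); rewrite lp.
Qed.

Lemma code_fun x p q : code x p -> code x q -> p = q.
Proof.
move=> cp cq; apply: inf_path_inj => n; exact: code_at_fun (cp n) (cq n).
Qed.

(** The level of [x] in [P n.+1] is the sum of the floors [elev (p i)] with [i <= n], as its level
    in [P 0] is 0; the tower is the range of [p n]. *)
Lemma code_cell x x' p q N : code x p -> code x' q ->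
  (forall n, n < N -> p n = q n) ->
  forall n, n < N -> tow (P n.+1) x = tow (P n.+1) x' /\
    lev (P n.+1) x = lev (P n.+1) x'.
Proof.
move=> cp cq pq; elim=> [|n IH] nN.
  have [tp _ lp] := cp 0; have [tq _ lq] := cq 0.
  by rewrite -tp -tq -lp -lq !P00 pq.
have [tp _ lp] := cp n.+1; have [tq _ lq] := cq n.+1.
by rewrite -tp -tq -lp -lq (IH (ltnW nN)).2 pq.
Qed.

Lemma code_local x x' p q N : code x p -> code x' q ->
  tow (P N) x = tow (P N) x' -> lev (P N) x = lev (P N) x' ->
  forall n, n < N -> p n = q n.
Proof.
move=> cp cq t l n nN; apply: code_at_fun (cp n) _.
have [t' l'] := refines_id_iter ref nN t l.
exact: code_at_same (esym t') (esym l') (cq n).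
Qed.

(** Floor 0 of every tower is a visit, so a minimal edge has floor 0, and these floors add up to the
    level of [x]. *)
Lemma code_min x p : code x p -> (forall n, emin (p n)) ->
  forall n, lev (P n) x = 0.
Proof.
move=> cp mp; elim=> [|n IH]; first exact: P00.
have [_ _ <-] := cp n; rewrite IH addn0.
have [||e [et el]] := @visit_ex _ _ _ _ id (P n) (P n.+1) (etow (p n)) 0.
  exact: ht_gt0.
  exact: lev_base (ref n) _.
have <- : e = p n by apply: mp; rewrite /= /visit_le et el eqxx.
exact: el.
Qed.

Lemma code_minP x p n : code x p -> lev (P n.+1) x = 0 -> emin (p n).
Proof.
move=> cp l0; have [_ _] := cp n; rewrite l0 => /eqP.
rewrite addn_eq0 => /andP[/eqP e0 _] e /andP[/eqP te].
by rewrite e0 leqn0 => /eqP le; apply: visit_inj => //; rewrite le e0.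
Qed.

Definition at_top n x := (lev (P n) x).+1 == ht (P n) (tow (P n) x).

Lemma at_topN n x : ~~ at_top n x -> (lev (P n) x).+1 < ht (P n) (tow (P n) x).
Proof. by move=> t; rewrite ltn_neqAle lev_lt andbT. Qed.

Lemma at_top0 x : at_top 0 x.
Proof.
by apply/negPn/negP => /at_topN h; have [_] := kr_up h; rewrite P00.
Qed.

(** From the top of [P n.+1] one moves to its base, hence to the base of [P n]; from below the top
    of [P n] one would reach a positive level. *)
Lemma at_topS n x : at_top n.+1 x -> at_top n x.
Proof.
apply: contraTT => tn; apply/negP => /eqP h; have := (ref n).1 _ (kr_top h).
by have [_ /= ->] := kr_up (at_topN tn).
Qed.

Lemma code_gap x p n (e : visits id (P n) (P n.+1)) : code x p ->
  etow (p n) = etow e -> elev (p n) < elev e ->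
  elev (p n) + ht (P n) (tow (P n) x) <= elev e.
Proof.
move=> cp te le; have [tx <- _] := cp n.
apply: (visit_gap idE (lev_visit (p n)) _ le).
by rewrite te; exact: (lev_visit e).
Qed.

(** A later visit would start above the block of floors containing [x], and this block already ends
    at the top of the tower. *)
Lemma code_max x p n : code x p -> at_top n.+1 x -> emax (p n).
Proof.
move=> cp tn e /andP[/eqP te]; rewrite leq_eqVlt => /orP[/eqP le|le].
  by apply: visit_inj.
have := code_gap cp te le; have /eqP <- := at_topS tn.
rewrite addnS; have [tx _ ->] := cp n; rewrite (eqP tn).
by rewrite -tx te leqNgt elev_lt.
Qed.

(** [phi x] enters the base of [P k] one floor higher in the same tower of [P k.+1], and [code_gap]
    excludes visits inside the block just left. *)
Lemma code_succ x p y q k : y = phi x -> code x p -> code y q -> at_top k x ->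
  ~~ at_top k.+1 x -> esucc (p k) (q k).
Proof.
move=> -> cp cq tk tk1; have [tu lu] := kr_up (at_topN tk1).
have [tp _ lp] := cp k; have [tq _] := cq k.
rewrite (kr_top (eqP tk)) addn0 lu -lp => lq.
have tpq : etow (p k) = etow (q k) by rewrite tp tq tu.
have lt : elev (p k) < elev (q k) by rewrite lq ltnS leq_addr.
split.
  apply/andP; split; first by apply/eqP => e; rewrite e ltnn in lt.
  by rewrite /= /visit_le tpq eqxx ltnW.
move=> e /andP[ne /andP[/eqP te le]]; rewrite /= /visit_le -tpq te eqxx /=.
rewrite leq_eqVlt in le; case/orP: le => [/eqP le|le].
  by move/eqP: ne; case; exact: visit_inj.
by rewrite lq -addnS (eqP tk); exact: (code_gap cp te le).
Qed.

Lemma code_graph x p q : code x p -> code (phi x) q -> vershik_graph p q.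
Proof.
move=> cp cq; have [tops|/existsNP[m tm]] := pselect (forall n, at_top n x).
  left; split=> n; first exact: code_max cp (tops n.+1).
  by apply: (code_minP cq); rewrite (kr_top (eqP (tops n.+1))).
have ex : exists n, ~~ at_top n x by exists m; apply/negP.
(* The first level at which [x] is not on top is positive, say [k.+1]; the edge that advances is
   then number [k]. *)
case: (ex_minnP ex) => -[|k]; first by rewrite at_top0.
move=> tk1 least.
have top n : n <= k -> at_top n x.
  by move=> nk; apply/negPn/negP => /least; rewrite ltnNge nk.
have nottop n : k < n -> ~~ at_top n x.
  elim: n => // n IH; rewrite ltnS leq_eqVlt => /orP[/eqP <- //|/IH].
  by apply: contra => /at_topS.
have suc := code_succ erefl cp cq (top k (leqnn k)) tk1.
right; exists k; split=> //.
- by move=> i ik; exact: code_max cp (top i.+1 ik).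
- exact: esucc_not_emax suc.
- by move=> i ik; apply: (code_minP cq); rewrite (kr_top (eqP (top i.+1 ik))).
- move=> i ki; apply/esym; apply: (code_at_fun (x := x)); first exact: cp.
  have [tq sq lq] := cq i.
  have [t l] := kr_up (at_topN (nottop i ki)).
  have [t' l'] := kr_up (at_topN (nottop i.+1 (ltnW ki))).
  by split; rewrite ?tq ?sq //; apply/eqP; rewrite -eqSS -addnS -l -l' lq.
Qed.

(** Inductively, the point is moved, within its cell of [P N], to the place in the tower of [P N.+1]
    that [p N] prescribes. *)
Lemma code_prefix p N :
  exists x, tow (P N) x = vert p N /\ forall n, n < N -> code_at x p n.
Proof.
elim: N => [|N [x [tx cx]]].
  case: X0 => x; exists x; split=> //; exact: card1_eq.
pose w := floor_pt (P N.+1) (etow (p N)) (elev (p N)).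
have w0 : lev (P N) w = 0 := lev_visit (p N).
have wt : tow (P N) w = tow (P N) x by rewrite tx.
pose L := lev (P N) x.
have [|t l] := @climb _ _ (P N) w L w0; first by rewrite wt lev_lt.
rewrite wt in t.
have fit : elev (p N) + ht (P N) (tow (P N) w) <= ht (P N.+1) (etow (p N)).
  exact: (visit_fit idE (ref N) (elev_lt (p N)) (lev_visit (p N))).
have [|t' l'] := @floor_ptP _ _ (P N.+1) (etow (p N)) (L + elev (p N)).
  by apply: leq_trans fit; rewrite addnC ltn_add2l wt lev_lt.
rewrite -iter_floor_pt in t' l'.
exists (iter L phi w); split; first by rewrite t' vertS.
move=> n; rewrite ltnS leq_eqVlt => /orP[/eqP ->|nN].
  by split; rewrite ?t' ?l' ?t ?l ?tx // addnC.
have [tn ln] := refines_id_iter ref nN t l.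
by apply: code_at_same (cx n nN).
Qed.

End Diagram.

(** * The coding as a conjugacy with the Vershik map *)

Section Topology.
Variable X : topologicalType.
Implicit Types x y : X.

Definition locally_constant (L : Type) (f : X -> L) : Prop :=
  forall x, \forall y \near x, f y = f x.

Hypothesis Xc : compact [set: X].

Lemma seq_cluster (u : nat -> X) :
  exists x, forall A, nbhs x A -> forall n, exists2 m, n <= m & A (u m).
Proof.
have [|x [_ cx]] := Xc (F := u @ \oo); first exact: filterT.
exists x => A xA n.
have [||y [[m /= nm <-] Ay]] := cx (u @` [set m | n <= m]) A; last by exists m.
  by exists n => // m nm; exists m.
by [].
Qed.

Variables (phi : X -> X) (P : nat -> kr phi).
Hypothesis phi_bij : bijective phi.
Hypothesis P00 : forall x, lev (P 0) x = 0.
Hypothesis P01 : #|tower (P 0)| = 1.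
Hypothesis ref : forall n, refines id (P n) (P n.+1).
Hypothesis X0 : inhabited X.
Hypothesis towc : forall n, locally_constant (tow (P n)).
Hypothesis levc : forall n, locally_constant (lev (P n)).
Hypothesis sep : forall x y,
  (forall n, tow (P n) x = tow (P n) y /\ lev (P n) x = lev (P n) y) -> x = y.
Hypothesis base1 : exists! x, forall n, lev (P n) x = 0.

Local Notation B := (kr_diagram P01 ref X0).
Local Notation code := (@code _ _ _ P01 ref X0).

Lemma cell_near n x :
  \forall y \near x, tow (P n) y = tow (P n) x /\ lev (P n) y = lev (P n) x.
Proof. by apply: filterS2 (towc n x) (levc n x) => y -> ->. Qed.

Lemma code_inj x y p : code x p -> code y p -> x = y.
Proof.
move=> cx cy; apply: sep => -[|n].
  by rewrite !P00; split=> //; exact: card1_eq.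
exact: (code_cell P00 cx cy (fun _ _ => erefl) (ltnSn n)).
Qed.

(** A cluster point of points realizing longer and longer prefixes works, because cells are open. *)
Lemma code_surj p : exists x, code x p.
Proof.
have /choice[u uP] := code_prefix p.
have [x xP] := seq_cluster u; exists x => n.
have [m nm [t l]] := xP _ (cell_near n.+1 x) n.+1.
by have [_ /(_ n nm)] := uP m; apply: code_at_same.
Qed.

Lemma kr_model : bratteli_vershik_model phi B.
Proof.
have [phi' phiK phiK'] := phi_bij.
have [b [b0 bu]] := base1.
have /choice[path pathP] := code_ex P01 ref X0.
have /choice[point pointP] := code_surj.
have pathK x : point (path x) = x by exact: code_inj (pointP _) (pathP x).
have pointK p : path (point p) = p by exact: code_fun (pathP _) (pointP p).
have point_base p : (forall n, lev (P n) (point p) = 0) -> p = path b.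
  by move=> /bu e; rewrite -(pointK p) -e.
(* The maximal path codes the preimage of [b]: below a top floor, that preimage would send [b] to a
   positive level. *)
have topb n : at_top P n (phi' b).
  apply/negPn/negP => tN; have [_] := kr_up (at_topN tN).
  by rewrite phiK' b0.
have po : properly_ordered B.
  split.
    exists (path (phi' b)); split=> [n|p mp].
      exact: code_max (pathP _) (topb n.+1).
    have top n : at_top P n (point p).
      elim: n => [|n IH]; first exact: at_top0.
      apply/negPn/negP => h.
      have suc := code_succ erefl (pointP p) (pathP _) IH h.
      exact: esucc_not_emax suc (mp n).
    rewrite -(pointK p); congr path; rewrite -[RHS]phiK; congr phi'.
    by apply: bu => n; rewrite (kr_top (eqP (top n))).
  exists (path b); split=> [n|p mp].
    exact: code_minP (pathP b) (b0 n.+1).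
  by apply/esym/point_base; exact: (code_min P00 (pointP p) mp).
have pathE x : path (phi x) = vershik (path x).
  by apply/(vershikP _ _ po); exact: code_graph (pathP _) (pathP _).
have path_cont : continuous path.
  apply/continuousP => A /inf_path_openE Ao; rewrite openE => x Ax.
  have [N NA] := Ao _ Ax; apply: filterS (cell_near N x) => y [t l].
  apply: NA => i iN; exact: (code_local (pathP y) (pathP x) t l).
(* If continuity fails at [p], there are paths converging to [p] whose points avoid [A]; a cluster
   point of these has the cells of [point p], hence equals it. *)
have point_cont : continuous point.
  apply/continuousP => A Ao; apply/inf_path_openE => p Ap.
  apply: contrapT => /forallNP far.
  have /choice[u uP] n : exists q, cylinder p n q /\ ~ A (point q).
    have /existsNP[q /not_implyP[pq nA]] := far n; by exists q.
  have [x xP] := seq_cluster (point \o u).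
  have xE : x = point p.
    apply: sep => -[|n].
      by rewrite !P00; split=> //; exact: card1_eq.
    have [m nm [<- <-]] := xP _ (cell_near n.+1 x) n.+1.
    apply: (code_cell P00 (pointP _) (pointP _) _ (ltnSn n)) => i il.
    by rewrite (uP m).1 // (leq_trans il nm).
  have [|m _] := xP A _ 0; last exact: (uP m).2.
  by apply: open_nbhs_nbhs; split=> //; rewrite xE.
split=> //; exists point; split.
  split=> // [x|p]; first by exists (path x).
  by rewrite -{1}(pointK p) -[in RHS](pathK (phi _)) pathE pointK.
by exists path.
Qed.

End Topology.

(** * From a factor map to a premorphism *)

Section LocallyConstant.
Variables (X : topologicalType).

Lemma lc_cst (L : Type) (c : L) : locally_constant (fun _ : X => c).
Proof. by move=> x; apply: filterE. Qed.

Lemma lc_comp (L M : Type) (g : L -> M) (f : X -> L) :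
  locally_constant f -> locally_constant (g \o f).
Proof. by move=> fc x; apply: filterS (fc x) => y /= ->. Qed.

Lemma lc_precomp (Y : topologicalType) (L : Type) (f : Y -> L) (g : X -> Y) :
  continuous g -> locally_constant f -> locally_constant (f \o g).
Proof. by move=> gc fc x; exact: gc _ _ (fc (g x)). Qed.

Lemma lc_pair (L M : Type) (f : X -> L) (g : X -> M) :
  locally_constant f -> locally_constant g ->
  locally_constant (fun x => (f x, g x)).
Proof. by move=> fc gc x; apply: filterS2 (fc x) (gc x) => y -> ->. Qed.

Lemma lc_fin (I : finType) (L : Type) (f : I -> X -> L) :
  (forall i, locally_constant (f i)) ->
  forall x, \forall y \near x, forall i, f i y = f i x.
Proof. by move=> fc x; apply: filter_forall => i; exact: fc. Qed.

Lemma lc_upto (L : Type) (f : nat -> X -> L) K :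
  (forall i, locally_constant (f i)) ->
  forall x, \forall y \near x, forall i, i < K -> f i y = f i x.
Proof.
move=> fc x; have := lc_fin (fun i : 'I_K => fc i) x.
by apply: filterS => y fy i iK; exact: fy (Ordinal iK).
Qed.

Lemma lc_bool (f : X -> bool) : continuous f -> locally_constant f.
Proof. by move=> fc x; apply: (fc x [set f x]); exact: discrete_set1. Qed.

Lemma iter_continuous (f : X -> X) n : continuous f -> continuous (iter n f).
Proof.
move=> fc; elim: n => [|n IH] x; first exact: cvg_id.
exact: continuous_comp (IH x) (fc _).
Qed.

End LocallyConstant.

Section FirstIndex.
Variables (p : pred nat) (K : nat).

(** The value is [K] when no index below [K] satisfies [p]. *)
Definition first_index := find p (iota 0 K).

Lemma first_indexP j : j < K -> p j ->
  [/\ first_index <= j, p first_index & forall i, i < first_index -> ~~ p i].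
Proof.
move=> jK pj; have has_p : has p (iota 0 K).
  by apply/hasP; exists j => //; rewrite mem_iota.
have lt : first_index < K by rewrite -[K in _ < K](size_iota 0) -has_find.
have nth_lt i : i < K -> nth 0 (iota 0 K) i = i by move=> iK; rewrite nth_iota.
have before i : i < first_index -> ~~ p i.
  move=> il; have := before_find 0 il; rewrite nth_lt; first by move=> ->.
  exact: ltn_trans lt.
split=> //.
  by rewrite leqNgt; apply/negP => /before; rewrite pj.
by rewrite -(nth_lt _ lt); exact: nth_find.
Qed.

Lemma first_index_uniq n : n < K -> p n -> (forall i, i < n -> ~~ p i) ->
  first_index = n.
Proof.
move=> nK pn before; have [le pf _] := first_indexP nK pn.
apply/eqP; rewrite eqn_leq le leqNgt; apply/negP => /before.
by rewrite pf.
Qed.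

End FirstIndex.

(** * Return times and Kakutani-Rohlin partitions over a clopen base *)

Section Returns.
Variables (X : topologicalType) (phi phi' : X -> X).
Hypothesis Xc : compact [set: X].
Hypotheses (phic : continuous phi) (phi'c : continuous phi').
Hypotheses (phiK : cancel phi phi') (phiK' : cancel phi' phi).
Hypothesis minimal : minimal_map phi.

Lemma iter_cancel j n x : j <= n ->
  iter j phi (iter n phi' x) = iter (n - j) phi' x.
Proof.
elim: j => [_|j IH jn]; first by rewrite subn0.
by rewrite /= IH ?(ltnW jn) // -[in LHS](subnSK jn) /= phiK'.
Qed.

Lemma iter_cancel' j n x : j <= n ->
  iter j phi' (iter n phi x) = iter (n - j) phi x.
Proof.
elim: j => [_|j IH jn]; first by rewrite subn0.
by rewrite /= IH ?(ltnW jn) // -[in LHS](subnSK jn) /= phiK.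
Qed.

Section Clopen.
Variables (z : X -> bool) (x0 : X).
Hypotheses (zc : locally_constant z) (zx0 : z x0).

Let fwc n : locally_constant (fun x => z (iter n phi x)).
Proof. exact: lc_precomp (iter_continuous phic) zc. Qed.

Let bwc n : locally_constant (fun x => z (iter n phi' x)).
Proof. exact: lc_precomp (iter_continuous phi'c) zc. Qed.

(** The points whose two-sided orbit avoids [z] form a closed invariant set without [x0], empty by
    minimality. *)
Lemma orbit_hits x : exists n, z (iter n phi x) || z (iter n phi' x).
Proof.
apply: contrapT => /forallNP nox.
pose A := [set y | forall n, ~ (z (iter n phi y) || z (iter n phi' y))].
have Acl : closed A.
  move=> y yA n; have := lc_pair (fwc n) (bwc n) y => /(yA _)[w [wA [e e']]].
  by rewrite -e -e'; exact: wA.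
have Ainv : phi @` A = A.
  apply/seteqP; split=> [_ [y yA <-] n|y yA].
    rewrite -iterSr; case: n => [|n].
      have := yA 1; rewrite /= => h1 /orP[h|h]; apply: h1; first by rewrite h.
      by rewrite h.
    rewrite (iterSr n phi') phiK => /orP[h|h].
      by apply: (yA n.+2); rewrite h.
    by apply: (yA n); rewrite h orbT.
  exists (phi' y); last exact: phiK'.
  move=> n; rewrite -(iterSr n phi') => /orP[|h]; last first.
    by apply: (yA n.+1); rewrite h orbT.
  case: n => [h|n]; first by apply: (yA 1); rewrite /= h orbT.
  by rewrite iterSr phiK' => h; apply: (yA n); rewrite h.
have [e|e] := minimal Acl Ainv.
  by have : A x by []; rewrite e.
by have : A x0 by [rewrite e]; move=> /(_ 0); rewrite /= zx0.
Qed.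

Lemma return_bound : exists K, forall x, exists2 j, j < K & z (iter j phi x).
Proof.
apply: contrapT => /forallNP unbounded.
have /choice[u uP] M : exists y, forall n, n <= M ->
    ~ (z (iter n phi y) || z (iter n phi' y)).
  have /existsNP[x xno] := unbounded (M + M).+1.
  (* The midpoint of a stretch of [2 M + 1] orbit points avoiding [z]; a cluster point of such
     midpoints contradicts [orbit_hits]. *)
  exists (iter M phi x) => n nM.
  rewrite iter_cancel' // -iterD => /orP[h|h]; apply: xno.
    by exists (n + M) => //; rewrite ltnS leq_add2r.
  by exists (M - n) => //; rewrite ltnS (leq_trans (leq_subr _ _)) // leq_addr.
have [y yP] := seq_cluster Xc u.
have [n hit] := orbit_hits y.
have [m nm [e e']] := yP _ (lc_pair (fwc n) (bwc n) y) n.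
by apply: (uP m n nm); rewrite e e'.
Qed.

(** The base is split according to the return time and the values of [c] met before returning, which
    makes [c] constant on every floor. *)
Lemma kr_ex (L : finType) (c : X -> L) : locally_constant c ->
  exists P : kr phi, [/\ locally_constant (tow P), locally_constant (lev P),
    forall x, lev P x = 0 <-> z x
  & forall x y, tow P x = tow P y -> lev P x = lev P y -> c x = c y].
Proof.
move=> cc; have [K KP] := return_bound.
have bwK x : exists2 j, j < K & z (iter j phi' x).
  have [j jK h] := KP (iter K.-1 phi' x).
  have jK1 : j <= K.-1 by rewrite -ltnS (ltn_predK jK).
  exists (K.-1 - j); first by rewrite -(ltn_predK jK) ltnS leq_subr.
  by rewrite -iter_cancel.
(* [back] is the time since the last visit to [z], and [ret] the first return time, shifted by one
   to exclude time 0. *)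
pose back x := first_index (fun j => z (iter j phi' x)) K.
pose ret x := (first_index (fun j => z (iter j.+1 phi x)) K).+1.
have backP x : [/\ back x < K, z (iter (back x) phi' x)
    & forall i, i < back x -> ~~ z (iter i phi' x)].
  have [j jK h] := bwK x.
  have [le ? ?] := first_indexP (p := fun j => z (iter j phi' x)) jK h.
  by split=> //; exact: leq_ltn_trans jK.
have back_uniq x n : z (iter n phi' x) ->
    (forall i, i < n -> ~~ z (iter i phi' x)) -> back x = n.
  move=> zn before; apply: first_index_uniq => //.
  have [j jK h] := bwK x; rewrite ltnNge; apply/negP => Kn.
  by have /negP := before j (leq_trans jK Kn).
have retP x : [/\ ret x <= K, z (iter (ret x) phi x)
    & forall i, 0 < i < ret x -> ~~ z (iter i phi x)].
  have [j jK h] := KP (phi x); rewrite -iterSr in h.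
  have [le zr before] := first_indexP (p := fun j => z (iter j.+1 phi x)) jK h.
  by split=> // [|[|i] //]; [exact: leq_ltn_trans jK|exact: before].
pose word x : 'I_K.+1 * {ffun 'I_K -> L} :=
  (inord (ret x), [ffun j : 'I_K => c (iter j phi x)]).
have word_ret x : (word x).1 = ret x :> nat.
  by rewrite /= inordK // ltnS; have [] := retP x.
(* Keeping only the words that occur over [z] gives every tower a base point. *)
pose T : finType := {w | `[< exists2 x, z x & word x = w >]}.
pose foot x := iter (back x) phi' x.
have footP x : `[< exists2 y, z y & word y = word (foot x) >].
  by apply/asboolP; exists (foot x) => //; have [] := backP x.
pose t x : T := exist _ (word (foot x)) (footP x).
have foot_iter j x : j <= back x ->
    iter j phi (foot x) = iter (back x - j) phi' x.
  exact: iter_cancel.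
have back_lt x : back x < ret (foot x).
  rewrite ltnNge; apply/negP => le; have [_ zr _] := retP (foot x).
  have lt : back x - ret (foot x) < back x.
    by rewrite ltn_subrL (leq_trans _ le).
  have [_ _ /(_ _ lt)] := backP x.
  by rewrite -foot_iter // zr.
have next x : iter (back x).+1 phi (foot x) = phi x.
  by rewrite /= foot_iter // subnn.
have up x : (back x).+1 < ret (foot x) ->
    t (phi x) = t x /\ back (phi x) = (back x).+1.
  move=> lt; have [_ _ noret] := retP (foot x); have [_ zb before] := backP x.
  have bS : back (phi x) = (back x).+1.
    apply: back_uniq; first by rewrite iterSr phiK.
    case=> [_|i]; first by rewrite /= -next noret.
    by rewrite ltnS iterSr phiK; exact: before.
  split=> //; apply/val_inj => /=; congr word.
  by rewrite /foot bS iterSr phiK.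
have top x : (back x).+1 = ret (foot x) -> back (phi x) = 0.
  move=> e; apply: back_uniq => //=; rewrite -next e.
  by have [] := retP (foot x).
have back0 x : z x -> back x = 0 by move=> zx; apply: back_uniq.
have ht_lt x : back x < (val (t x)).1 by rewrite word_ret.
have ht_up x : (back x).+1 < (val (t x)).1 ->
    t (phi x) = t x /\ back (phi x) = (back x).+1.
  by rewrite word_ret; exact: up.
have ht_top x : (back x).+1 = (val (t x)).1 -> back (phi x) = 0.
  by rewrite word_ret; exact: top.
have base v : exists2 x, t x = v & back x = 0.
  case: v => w wP; have /asboolP[x zx xw] := wP.
  exists x; last exact: back0.
  by apply/val_inj; rewrite /= /foot back0.
have bc : locally_constant back.
  move=> x; apply: filterS (lc_upto K bwc x) => y yx.
  by apply: eq_in_find => j; rewrite mem_iota /= => jK; exact: yx.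
exists (@KR _ _ T t back (fun v => (val v).1) ht_lt ht_up ht_top base).
split=> //=.
- move=> x; set n := back x.
  (* Near [x] the foot is computed with the constant exponent [n], hence continuously. *)
  have wc : \forall y \near x, word (iter n phi' y) = word (iter n phi' x).
    apply: (lc_precomp (@iter_continuous _ _ n phi'c) (f := word)).
    apply: lc_pair.
      apply: lc_comp => w.
      apply: filterS (lc_upto K (fun j => fwc j.+1) w) => y yw.
      by congr S; apply: eq_in_find => j; rewrite mem_iota /= => jK; exact: yw.
    have cj (j : 'I_K) : locally_constant (fun x => c (iter j phi x)).
      exact: lc_precomp (iter_continuous phic) cc.
    move=> w; apply: filterS (lc_fin cj w) => y yw.
    by apply/ffunP => j; rewrite !ffunE.
  apply: filterS2 (bc x) wc => y yb yw; apply/val_inj => /=.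
  by rewrite /foot yb.
- move=> x; split=> [b0|]; last exact: back0.
  by have [_] := backP x; rewrite b0.
(* [c x] is the letter of index [back x] in the word of the foot of [x]. *)
- move=> x y [_ /ffunP w] b.
  have [bK _ _] := backP x; have := w (Ordinal bK).
  by rewrite !ffunE /= foot_iter // b foot_iter // !subnn.
Qed.

End Clopen.

(** The cell of [x] with values in a finite type, as [kr_ex] requires of a label to be refined. *)
Definition cell_label (P : kr phi) x :
    tower P * 'I_(\max_(v : tower P) ht P v).+1 := (tow P x, inord (lev P x)).

Lemma cell_labelP (P : kr phi) x y : cell_label P x = cell_label P y ->
  tow P x = tow P y /\ lev P x = lev P y.
Proof.
move=> [-> /(congr1 val)].
have bound w : lev P w < (\max_(v : tower P) ht P v).+1.
  rewrite ltnS ltnW // (leq_trans (lev_lt P w)) //.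
  exact: (@leq_bigmax_cond _ _ (ht P)).
by rewrite /= !inordK.
Qed.

Lemma cell_label_lc (P : kr phi) : locally_constant (tow P) ->
  locally_constant (lev P) -> locally_constant (cell_label P).
Proof. by move=> tc lc; apply: lc_pair => //; exact: lc_comp. Qed.

(** Each new partition comes from [kr_ex], with [c n] paired with the cell label of the previous
    one; decreasing sets [z n] give nested bases. *)
Lemma kr_sequence (X0 : inhabited X) (x0 : X) (z : nat -> X -> bool)
    (L : nat -> finType) (c : forall n, X -> L n) :
  (forall n, locally_constant (z n)) -> (forall n, locally_constant (c n)) ->
  (forall n, z n x0) -> (forall n x, z n.+1 x -> z n x) ->
  exists P : nat -> kr phi,
    [/\ P 0 = kr0 phi X0, forall n, refines id (P n) (P n.+1),
        forall n, locally_constant (tow (P n)) /\ locally_constant (lev (P n)),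
        forall n x, lev (P n.+1) x = 0 <-> z n x
      & forall n x y, tow (P n.+1) x = tow (P n.+1) y ->
          lev (P n.+1) x = lev (P n.+1) y -> c n x = c n y].
Proof.
move=> zc cc zx0 zmono.
pose good (P : kr phi) := locally_constant (tow P) /\ locally_constant (lev P).
have /all_tag[step stepP] (n : nat) : {s : {P | good P} -> {P | good P} &
    forall P, (forall x, lev (sval (s P)) x = 0 <-> z n x) /\
      forall x y, tow (sval (s P)) x = tow (sval (s P)) y ->
      lev (sval (s P)) x = lev (sval (s P)) y ->
      c n x = c n y /\ cell_label (sval P) x = cell_label (sval P) y}.
  apply: (@choice _ _ (fun P P' : {P | good P} =>
    (forall x, lev (sval P') x = 0 <-> z n x) /\
      forall x y, tow (sval P') x = tow (sval P') y ->
      lev (sval P') x = lev (sval P') y ->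
      c n x = c n y /\ cell_label (sval P) x = cell_label (sval P) y)).
  move=> [P [tc lc]] /=.
  have [P' [tc' lc' bP' cP']] :=
    kr_ex (zc n) (zx0 n) (lc_pair (cc n) (cell_label_lc tc lc)).
  exists (exist _ P' (conj tc' lc')); split=> //= x y t l.
  by have [-> e1 e2] := cP' _ _ t l; split=> //; rewrite /cell_label e1 e2.
have good0 : good (kr0 phi X0) by split; exact: lc_cst.
pose P := fix P n : {P | good P} :=
  if n is m.+1 then step m (P m) else exist _ _ good0.
have base n x : lev (sval (P n.+1)) x = 0 <-> z n x := (stepP n (P n)).1 x.
exists (fun n => sval (P n)); split=> // [n|n|n x y t l].
- split=> [x /base zx|x y t l].
    by case: n zx => [//|n] zx; apply/base; exact: zmono.
  by have [_ /cell_labelP] := (stepP n (P n)).2 x y t l.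
- exact: svalP (P n).
- by have [] := (stepP n (P n)).2 x y t l.
Qed.

End Returns.

(** * Isomorphisms for the commutation relation *)

Lemma ocomp_isor (S T U : finType) (F : oedges S T) (G G' : oedges T U) :
  oedges_iso G G' -> oedges_iso (ocomp F G) (ocomp F G').
Proof.
move=> [h [hb hs hr hle]].
have [h' hK h'K] := hb.
have adj (p : ocomp F G) : rng F (val p).1 == src G' (h (val p).2).
  by rewrite hs ocomp_adj.
pose k (p : ocomp F G) : ocomp F G' := exist _ (_, _) (adj p).
apply: (@oedges_isoI _ _ (ocomp F G) (ocomp F G') k) => [q|//|p|p q].
- have [|p pE] := @ocomp_pair _ _ _ F G (val q).1 (h' (val q).2).
    by rewrite ocomp_adj -{1}(h'K (val q).2) hs.
  by exists p; apply: ocomp_inj => /=; rewrite pE //= h'K.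
- by rewrite /= /comp_rng /= hr.
- by rewrite /= /comp_le /elt /= hle (can_eq hK).
Qed.

Lemma seg1 (B : ordered_bratteli) n (nn : n <= n.+1) :
  oedges_iso (seg B nn) (edg B n).
Proof.
rewrite /seg; move: (n.+1 - n) (subnK nn) => d e.
(* With [d = 1] the transport is trivial, and what remains is [edg B n] preceded by identity
   edges. *)
have d1 : d = 1 by apply: (@addIn n); rewrite e.
subst d; have -> : e = erefl by exact: eq_irrelevance.
have adj (g : edg B n) :
    rng (oid (vtx B n)) (src (edg B n) g) == src (edg B n) g.
  exact: eqxx.
apply: (@oedges_isoI _ _ (ocomp (oid (vtx B n)) (edg B n)) (edg B n)
  (fun p => (val p).2)) => [g|p|//|p q].
- by exists (exist _ (src (edg B n) g, g) (adj g)).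
- by rewrite -ocomp_adj.
- rewrite /= /comp_le /elt.
  case: (eqVneq (val p).2 (val q).2) => [e'|] /=; last by rewrite orbF.
  rewrite e' ele_refl; apply/esym/eqP.
  have := ocomp_adj p; have := ocomp_adj q; rewrite /= => -> ->.
  by rewrite e'.
Qed.

(** * Models and premorphism of a factor map *)

Section FactorModels.
Variables (X Y : topologicalType) (phi : X -> X) (psi : Y -> Y).
Hypotheses (cms_phi : cantor_minimal_system phi).
Hypotheses (cms_psi : cantor_minimal_system psi).
Variable alpha : X -> Y.
Hypothesis factor : factor_map phi psi alpha.

Lemma factor_models : exists C B : ordered_bratteli,
  [/\ bratteli_vershik_model phi C, bratteli_vershik_model psi B
    & inhabited (ordered_premorphism B C)].
Proof.
have [[hX hXh] [phi' [phic phi'c phiK phiK']] phim] := cms_phi.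
have [[hY hYh] [psi' [psic psi'c psiK psiK']] psim] := cms_psi.
have [alphac alphas alphaE] := factor.
have [Xc Yc] := (cantor_compact hXh, cantor_compact hYh).
(* Binary coordinates: locally constant functions that separate points. *)
have coord (Z : topologicalType) (h : Z -> cantor_space) :
    homeomorphism h -> (forall n, locally_constant (h ^~ n)) /\
      (forall x y, (forall n, h x n = h y n) -> x = y).
  move=> [g [hc _ hK _]]; split=> [n|x y xy].
    apply: lc_bool => x.
    apply: (@continuous_comp _ _ _ h (fun w : cantor_space => w n) x (hc x)).
    exact: (@proj_continuous _ (fun=> bool) n).
  by apply: (can_inj hK); apply: functional_extensionality_dep.
have [hXc hXsep] := coord _ _ hXh; have [hYc hYsep] := coord _ _ hYh.
have [g0 _] := hXh; pose x0 := g0 (fun=> false).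
pose y0 := alpha x0.
have X0 : inhabited X by exists; exact: x0.
have Y0 : inhabited Y by exists; exact: y0.
pose near_base (Z : Type) (h : Z -> cantor_space) b n x :=
  [forall i : 'I_n.+1, h x i == h b i].
have near_lc (Z : topologicalType) (h : Z -> cantor_space) b n :
    (forall n, locally_constant (h ^~ n)) ->
    locally_constant (near_base Z h b n).
  move=> hc x; apply: filterS (lc_fin (fun i : 'I_n.+1 => hc i) x) => y yx.
  by apply: eq_forallb => i; rewrite yx.
have near_mono (Z : Type) (h : Z -> cantor_space) b n x :
    near_base Z h b n.+1 x -> near_base Z h b n x.
  move=> /forallP nb; apply/forallP => i.
  exact: nb (widen_ord (leqnSn n.+1) i).
have near_self (Z : Type) (h : Z -> cantor_space) b n : near_base Z h b n b.
  exact/forallP.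
have near_coord (Z : Type) (h : Z -> cantor_space) b n x :
    near_base Z h b n x -> h x n = h b n.
  by move=> /forallP/(_ ord_max)/eqP.
have [Q [Q0 Qref Qlc Qbase Qcell]] := kr_sequence Yc psic psi'c psiK psiK' psim
  Y0 (z := near_base Y hY y0) (L := fun=> bool) (c := fun n => hY ^~ n)
  (fun n => near_lc Y hY y0 n hYc) hYc (near_self Y hY y0) (near_mono Y hY y0).
(* The second factor sends the base of [P n.+1] into that of [Q n.+1]; in [cX] the cell label does
   the same for cells, and [hX x n] separates points. *)
pose zX n x := near_base X hX x0 n x && near_base Y hY y0 n (alpha x).
pose cX n x := (hX x n, cell_label (Q n.+1) (alpha x)).
have zXc n : locally_constant (zX n).
  apply: (lc_comp (fun p : bool * bool => p.1 && p.2)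
    (f := fun x => (near_base X hX x0 n x, near_base Y hY y0 n (alpha x)))).
  apply: lc_pair; first exact: near_lc.
  by apply: lc_precomp alphac _; exact: near_lc.
have cXc n : locally_constant (cX n).
  apply: lc_pair; first exact: hXc.
  by apply: lc_precomp alphac _; apply: cell_label_lc; have [] := Qlc n.+1.
have [||P [P0 Pref Plc Pbase Pcell]] :=
  kr_sequence Xc phic phi'c phiK phiK' phim
  X0 (x0 := x0) zXc cXc.
- by move=> n; rewrite /zX !near_self.
- move=> n x /andP[zx zy].
  by rewrite /zX (near_mono _ _ _ _ _ zx) (near_mono _ _ _ _ _ zy).
have QP n : refines alpha (Q n) (P n).
  case: n => [|n].
    by rewrite Q0; split.
  split=> [x /Pbase/andP[_ zy]|x x' t l]; first exact/Qbase.
  have [_ e1 e2] := Pcell _ _ _ t l.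
  by apply: cell_labelP; rewrite /cell_label e1 e2.
have Q00 y : lev (Q 0) y = 0 by rewrite Q0.
have P00 x : lev (P 0) x = 0 by rewrite P0.
have Q01 : #|tower (Q 0)| = 1 by rewrite Q0 card_unit.
have P01 : #|tower (P 0)| = 1 by rewrite P0 card_unit.
have Bmodel : bratteli_vershik_model psi (kr_diagram Q01 Qref Y0).
  apply: kr_model => //.
  - by exists psi'.
  - by move=> n; have [] := Qlc n.
  - by move=> n; have [] := Qlc n.
  - move=> x y xy; apply: hYsep => n.
    by have [t l] := xy n.+1; exact: Qcell t l.
  - exists y0; split=> [[|n]//|y y0P]; first by apply/Qbase; exact: near_self.
    by apply: hYsep => n; apply/esym/near_coord/Qbase.
have Cmodel : bratteli_vershik_model phi (kr_diagram P01 Pref X0).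
  apply: kr_model => //.
  - by exists phi'.
  - by move=> n; have [] := Plc n.
  - by move=> n; have [] := Plc n.
  - move=> x y xy; apply: hXsep => n.
    by have [t l] := xy n.+1; have [] := Pcell _ _ _ t l.
  - exists x0; split=> [[|n]//|x x0P].
      by apply/Pbase; rewrite /zX !near_self.
    apply: hXsep => n; apply/esym/near_coord.
    by have /Pbase/andP[] := x0P n.+1.
exists (kr_diagram P01 Pref X0), (kr_diagram Q01 Qref Y0); split=> //; exists.
pose B := kr_diagram Q01 Qref Y0; pose C := kr_diagram P01 Pref X0.
pose F n : oedges (vtx B n) (vtx C n) := visits alpha (Q n) (P n).
have F0 : #|F 0| = 1.
  apply/eqP; rewrite eqn_leq (visits_card_gt0 (QP 0) X0) andbT.
  apply/fintype_le1P => e f.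
  have lev0 (g : F 0) : elev g = 0.
    by have := elev_lt g; rewrite ht_trivial //; case: (elev g).
  by apply: visit_inj; [exact: card1_eq|rewrite !lev0].
(* The level sequence is [f_n = n], since [P n] is compared with [Q n]. *)
apply: (@OrderedPremorphism B C id erefl leqnSn
  (fun m => ex_intro _ m (leqnn m)) F
  (fun n => visits_card_gt0 (QP n) X0)
  (fun n => visits_src_surj alphaE (QP n) alphas)
  (fun n => visits_rng_surj (QP n)) F0) => n.
(* Both sides are visits from [Q n] to [P n.+1], along [id \o alpha] and [alpha \o id], which are
   convertible. *)
have left_iso := @ocomp_visits _ _ _ _ _ _ id alpha (fun=> erefl) alphaE
  _ _ _ (Qref n) (QP n.+1).
have right_iso := @ocomp_visits _ _ _ _ _ _ alpha id alphaE (fun=> erefl)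
  _ _ _ (QP n) (Pref n).
apply: (oedges_iso_trans left_iso); apply: oedges_iso_sym.
exact: (oedges_iso_trans (ocomp_isor _ (seg1 C (leqnSn n))) right_iso).
Qed.

End FactorModels.

Theorem theorem4p7 (X Y : topologicalType) (phi : X -> X) (psi : Y -> Y)
    (cms_phi : cantor_minimal_system phi)
    (cms_psi : cantor_minimal_system psi) :
  (exists alpha : X -> Y, factor_map phi psi alpha)
  <->
  (exists C B : ordered_bratteli,
    [/\ bratteli_vershik_model phi C,
        bratteli_vershik_model psi B
      & inhabited (ordered_premorphism B C)]).
Proof.
split=> [[alpha alphaP]|[C [B [Cmodel Bmodel [f]]]]].
  exact: factor_models cms_phi cms_psi alpha alphaP.
exact: premorphism_factor cms_phi cms_psi Cmodel Bmodel f.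
Qed.
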